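(* Let $\alpha,\beta,\alpha_1,\beta_1\in\mathbb{R}$ with $\beta\neq 0$, $\beta\neq\beta_1$, and let $0<\mu\le 1$, $0\le\nu\le 1$. Consider the cobweb model with Hilfer fractional derivative in the demand function: for an unknown price function $p$ on $(0,\infty)$, $$D(t)=\alpha+\beta\bigl(p(t)+D_{0+}^{\mu,\nu}p(t)\bigr),\qquad S(t)=\alpha_1+\beta_1 p(t),\qquad D(t)=S(t)\qquad (t>0).$$ Assume $\dfrac{\beta_1}{\beta}<1$. Then every solution $p$ of this model converges to the equilibrium value $p_e=\dfrac{\alpha_1-\alpha}{\beta-\beta_1}$, that is, $\lim_{t\to+\infty}p(t)=p_e$.
   Context: For $\sigma>0$ the Riemann-Liouville fractional integral is $I_{0+}^{\sigma}g(t)=\frac{1}{\Gamma(\sigma)}\int_0^t (t-s)^{\sigma-1}g(s)\,ds$, and $I_{0+}^{0}g=g$. For $0<\mu\le 1$ and $0\le\nu\le 1$ the Hilfer fractional derivative of order $\mu$ and type $\nu$ is $D_{0+}^{\mu,\nu}g=I_{0+}^{\nu(1-\mu)}\,\frac{d}{dt}\,I_{0+}^{(1-\nu)(1-\mu)}g$ (for $\mu=1$ this is the ordinary derivative). A solution of the model means a continuous function $p:(0,\infty)\to\mathbb{R}$, integrable on $(0,T)$ for every $T>0$, such that $I_{0+}^{(1-\nu)(1-\mu)}p$ extends to an absolutely continuous function on $[0,T]$ for every $T>0$, and such that the model equations hold for almost every $t>0$. *)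

(* Defs.v *)
From HB Require Import structures.
From mathcomp Require Import all_boot all_order all_algebra.
From mathcomp Require Import all_classical all_reals all_analysis.
Import Order.TTheory GRing.Theory Num.Theory.
Import numFieldNormedType.Exports.

Set Implicit Arguments.
Unset Strict Implicit.
Unset Printing Implicit Defensive.

Local Open Scope classical_set_scope.
Local Open Scope ring_scope.

Definition Gamma (R : realType) (sigma : R) : R :=
  \int[@lebesgue_measure R]_(x in `]0, +oo[) (x `^ (sigma - 1) * expR (- x)).

(* Meaningful for [0 <= sigma] and [0 < t]; only the values of [g] on
   ]0, t] are used.  Where the integrand is not integrable, the value is the
   default one of [Rintegral]. *)
Definition RL_integral (R : realType) (sigma : R) (g : R -> R) : R -> R :=
  if sigma == 0 then g else fun t =>
    (Gamma sigma)^-1 *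
    \int[@lebesgue_measure R]_(s in `]0, t[) ((t - s) `^ (sigma - 1) * g s).

(* [derive1 f] takes a default value at the points where [f] is not derivable. *)
Definition Hilfer_derivative (R : realType) (mu nu : R) (g : R -> R) : R -> R :=
  RL_integral (nu * (1 - mu))
    (derive1 (RL_integral ((1 - nu) * (1 - mu)) g)).

Definition absolutely_continuous_on (R : realType) (a b : R) (F : R -> R) :=
  forall eps : R, 0 < eps -> exists2 delta : R, 0 < delta &
    forall (n : nat) (u v : 'I_n -> R),
      (forall i, a <= u i /\ u i <= v i /\ v i <= b) ->
      trivIset [set: 'I_n] (fun i => [set` `]u i, v i[]) ->
      \sum_(i < n) (v i - u i) < delta ->
      \sum_(i < n) `|F (v i) - F (u i)| < eps.

Definition demand (R : realType) (alpha beta mu nu : R) (p : R -> R) (t : R) :=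
  alpha + beta * (p t + Hilfer_derivative mu nu p t).

Definition supply (R : realType) (alpha1 beta1 : R) (p : R -> R) (t : R) :=
  alpha1 + beta1 * p t.

(* Prices live on ]0, +oo[: the values of [p] outside it are irrelevant. *)
Record cobweb_solution (R : realType) (alpha beta alpha1 beta1 mu nu : R)
    (p : R -> R) : Prop := CobwebSolution {
  cobweb_continuous : forall t : R, 0 < t -> {for t, continuous p} ;
  cobweb_integrable : forall T : R, 0 < T ->
    (@lebesgue_measure R).-integrable `]0, T[ (EFin \o p) ;
  cobweb_abs_cont : forall T : R, 0 < T -> exists F : R -> R,
    (forall t : R, 0 < t -> t <= T ->
       F t = RL_integral ((1 - nu) * (1 - mu)) p t) /\
    absolutely_continuous_on 0 T F ;
  cobweb_equation : {ae @lebesgue_measure R, forall t : R, 0 < t ->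
    demand alpha beta mu nu p t = supply alpha1 beta1 p t}
}.

(* Main.v *)
From HB Require Import structures.
Require Import Defs.
From mathcomp Require Import all_boot all_order all_algebra.
From mathcomp Require Import all_classical all_reals all_analysis.
From mathcomp Require Import measurable_realfun ring lra.
Import Order.TTheory GRing.Theory Num.Theory.
Import numFieldNormedType.Exports.
Local Open Scope classical_set_scope.
Local Open Scope ring_scope.
Set Implicit Arguments.
Unset Strict Implicit.
Unset Printing Implicit Defensive.

(** Put [a = (1 - nu)(1 - mu)] and [q = p - p_e].  Applying complementary
    fractional integrals to the model equation turns it into the Volterra equation
      [q t = C t^(-a) - p_e - k int_0^t (t - s)^(mu - 1) q s ds],  [k > 0],
    in which only the sign of the constant [k] matters.  This uses that an
    absolutely continuous function is the integral of its a.e. derivative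
    (Radon-Nikodym for the Lebesgue-Stieltjes measure of its variation).

    The kernel [t^(mu - 1)] is log-convex, which gives a comparison principle: if
    [z t = g t - k int_0^t (t - s)^(mu - 1) z s ds] with [g >= 0] and
    [g t * t^(1 - mu)] nondecreasing, then [z >= 0].  On a short time interval it
    follows from one iteration of the equation and a contraction in [L^1]; the two
    hypotheses are inherited by the equation restarted at a later time, so it
    propagates to all times.

    For [mu < 1] it applies to [z = W + q] and [z = W - q] with
    [W t = A t^(-theta) + |C| t^(-a)], [theta] small and [A] large, and for [mu = 1]
    to [W t = A exp(- k t)].  Hence [|q| <= W], and [W] tends to [0]. *)

(** * Affine changes of variable *)

(** The solution can be written with Mittag-Leffler functions; comparison replaces their
    asymptotics. The bound [W] tends to 0, yet [W] plus [k] times its fractional integral of order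
    [mu] stays above a constant, because the integral of t^(-theta) is a multiple of the growing
    power t^(mu - theta). The weight t^(1 - mu) in the comparison principle asks for theta < 1 - mu,
    which leaves no room when [mu] is 1.

    The obstacle throughout is the singularity at 0: the kernel is unbounded there, the price may
    blow up like t^(-a), and convolutions converge for almost every time only. Hence identities are
    kept almost everywhere, the times at which the equation is restarted are picked outside a null
    set, and the pointwise bound is recovered at the very end from the continuity of [p] and [W]. *)

Section AffineChange.
Context {R : realType}.
Local Notation mu := (@lebesgue_measure R).

Lemma measurable_affine (a b : R) :
  measurable_fun [set: R] (fun x => a * x + b : R).
Proof.
by apply: measurable_funD => //; apply: measurable_funM.
Qed.

(** By uniqueness of Lebesgue measure: the pushforward scaled by [|a|] has the right value on every
    []u, v]]. For negative [a] the preimage is closed on the left and open on the right. *)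
Lemma lebesgue_measure_affine (a b : R) (A : set R) : a != 0 ->
  measurable A -> (mu ((fun x => a * x + b)%R @^-1` A) * `|a|%:E = mu A)%E.
Proof.
move=> a0 mA.
have mphi : measurable_fun [set: measurableTypeR R]
    ((fun x => a * x + b) : measurableTypeR R -> measurableTypeR R).
  exact: measurable_affine.
pose P : {measure set (measurableTypeR R) -> \bar R} := pushforward mu
  ((fun x => a * x + b) : measurableTypeR R -> measurableTypeR R).
suff -> : mu A = mscale (NngNum (normr_ge0 a)) (P mphi) A.
  by apply/esym; exact: muleC.
apply: lebesgue_measure_unique => // _ [[u v]] _ <-.
rewrite [RHS](_ : _ = `|a|%:E *
  mu ((fun x => (a * x + b)%R) @^-1` `]u, v]%classic))%E// muleC.
have [agt0|alt0] := ltP 0 a.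
  rewrite (_ : _ @^-1` _ = `](u - b) / a, (v - b) / a]%classic); last first.
    apply/seteqP; split => x /=;
      by rewrite !in_itv/= ltr_pdivrMr// ler_pdivlMr// (mulrC x) ltrBlDr lerBrDr.
  rewrite !lebesgue_measure_itv/= !lte_fin ltr_pM2r ?invr_gt0// ltrD2r.
  case: ifPn => uv; last by rewrite ?mul0e ?mule0.
  rewrite -!EFinD -EFinM gtr0_norm//; congr EFin.
  by field.
have {}alt0 : a < 0 by rewrite lt_neqAle a0.
rewrite (_ : _ @^-1` _ = `[(v - b) / a, (u - b) / a[%classic); last first.
  apply/seteqP; split => x /=;
  rewrite !in_itv/= ltr_ndivlMr// ler_ndivrMr// (mulrC x) ltrBlDr lerBrDr;
  by move=> /andP[-> ->].
rewrite !lebesgue_measure_itv/= !lte_fin ltr_nM2r ?invr_lt0// ltrD2r.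
case: ifPn => uv; last by rewrite ?mul0e ?mule0.
rewrite -!EFinD -EFinM ltr0_norm//; congr EFin.
by field.
Qed.

Lemma ge0_integral_affine (a b : R) (f : R -> \bar R) : a != 0 ->
  measurable_fun [set: R] f -> (forall x, 0 <= f x)%E ->
  (\int[mu]_x f x = `|a|%:E * \int[mu]_x f (a * x + b)%R)%E.
Proof.
move=> a0 mf f0.
have mphi : measurable_fun [set: measurableTypeR R]
    ((fun x => a * x + b) : measurableTypeR R -> measurableTypeR R).
  exact: measurable_affine.
have := @ge0_integral_pushforward _ _ _ _ _ _ mphi mu setT f measurableT mf
  (fun x _ => f0 x).
rewrite /comp preimage_setT => <-.
pose P : {measure set (measurableTypeR R) -> \bar R} := pushforward mu
  ((fun x => a * x + b) : measurableTypeR R -> measurableTypeR R).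
rewrite -(@ge0_integral_mscale _ _ _ (P mphi) setT measurableT
  (NngNum (normr_ge0 a)) f mf)//.
apply: eq_measure_integral => A mA _.
rewrite [RHS](_ : _ = `|a|%:E *
  mu ((fun x => (a * x + b)%R) @^-1` A))%E// muleC.
by apply/esym; exact: lebesgue_measure_affine.
Qed.

End AffineChange.

(** * Integrals of powers *)

Section RLKernel.
Context {R : realType}.
Local Notation mu := (@lebesgue_measure R).
Implicit Types (s t x : R).

(** The integrand is singular at 0 when [s < 1], so the fundamental theorem is applied away from 0
    and monotone convergence does the rest. *)
Lemma integral_powR s t : 0 < s -> 0 <= t ->
  (\int[mu]_(x in `]0%R, t[) (x `^ (s - 1))%R%:E = (t `^ s / s)%R%:E)%E.
Proof.
move=> s0; rewrite le_eqVlt => /predU1P[<-|t0].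
  by rewrite set_itvoo0 integral_set0 powR0 ?gt_eqF// mul0r.
have mp : measurable_fun [set: R] (fun x : R => (x `^ (s - 1))%R%:E).
  by apply/measurable_EFinP; exact: measurable_powR.
rewrite integral_itv_bndo_bndc; last exact: measurable_funTS.
(* With [n.+2] the left end is strictly below [t] already for [n = 0]. *)
pose F n : set R := `[t / n.+2%:R, t]%classic.
have F_ub : \bigcup_n F n = `]0, t]%classic.
  apply/seteqP; split => x /=.
    move=> [n _]; rewrite /F/= !in_itv/= => /andP[ax ->]; rewrite andbT.
    by apply: lt_le_trans ax; rewrite divr_gt0.
  rewrite in_itv/= => /andP[x0 xt].
  exists (Num.truncn (t / x)) => //; rewrite /F/= in_itv/= xt andbT.
  rewrite ler_pdivrMr// mulrC -ler_pdivrMr//.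
  apply: (@le_trans _ _ (Num.truncn (t / x)).+1%:R); last by rewrite ler_nat.
  by apply/ltW; rewrite truncnS_gt// divr_ge0// ltW.
have c1 : (\int[mu]_(x in F n) (x `^ (s - 1))%R%:E)%E @[n --> \oo] -->
    (\int[mu]_(x in `]0%R, t]) (x `^ (s - 1))%R%:E)%E.
  rewrite -F_ub; apply: ge0_nondecreasing_set_cvg_integral => //.
  - move=> m n mn; apply/subsetPset => x; rewrite /F/= !in_itv/= => /andP[h ->].
    rewrite andbT; apply: le_trans h; rewrite ler_pM2l// lef_pV2 ?posrE//.
    by rewrite ler_nat !ltnS.
  - by move=> n; exact: measurable_itv.
  - by move=> n; exact: measurable_funTS.
  - by move=> n x _; rewrite lee_fin powR_ge0.
have FE n : (\int[mu]_(x in F n) (x `^ (s - 1))%R%:E =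
    ((t `^ s - (t / n.+2%:R) `^ s) / s)%R%:E)%E.
  have a0 : 0 < t / n.+2%:R by rewrite divr_gt0.
  have at_ : t / n.+2%:R < t by rewrite gtr_pMr// invf_lt1// ltr1n.
  have der x : 0 < x -> is_derive x 1 (fun x => x `^ s / s) (x `^ (s - 1)).
    move=> x0; have := is_derive1_powR s x0 => h.
    have := @is_deriveM _ _ (@powR R ^~ s) (cst s^-1) x 1 _ _ h (is_derive_cst _ _ _).
    rewrite scaler0 add0r /= => {}h; apply: is_derive_eq h _.
    by rewrite /cst /GRing.scale/= mulrA mulVf ?mul1r// gt_eqF.
  have cts x : 0 < x -> {for x, continuous (fun x => x `^ s / s)}.
    move=> x0; apply/differentiable_continuous/derivable1_diffP.
    by have [] := der x x0.
  rewrite (@continuous_FTC2 _ _ (fun x => x `^ s / s))//.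
  - by rewrite -EFinB mulrBl.
  - apply: derivable_within_continuous => x; rewrite in_itv/= => /andP[ax _].
    by apply: derivable_powR; rewrite in_itv/= andbT (lt_le_trans a0).
  - split.
    + move=> x; rewrite in_itv/= => /andP[ax _].
      by have [] := der x (lt_trans a0 ax).
    + exact/cvg_at_right_filter/cts.
    + exact/cvg_at_left_filter/cts.
  - move=> x; rewrite in_itv/= => /andP[ax _].
    by rewrite derive1E; have [_ ->] := der x (lt_trans a0 ax).
have c2 : (\int[mu]_(x in F n) (x `^ (s - 1))%R%:E)%E @[n --> \oo] -->
    (t `^ s / s)%:E.
  under eq_fun do rewrite FE.
  apply: cvg_EFin; first exact: nearW.
  rewrite /comp/= -[X in _ --> X](_ : (t `^ s - 0) / s = _); last by rewrite subr0.
  apply: cvgMl; apply: cvgB; first exact: cvg_cst.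
  have /cvg_at_rightP := powR_cvg0 s0; apply; split.
    by move=> n; rewrite divr_gt0.
  rewrite -[X in _ --> X](mulr0 t); apply: cvgMr.
  by have := @cvg_harmonic R; rewrite -(cvg_shiftS (@harmonic R)).
exact: (cvg_unique _ c1 c2).
Qed.

End RLKernel.

(** * Convolution on the line *)

Section Convolution.
Context {R : realType}.
Local Notation mu := (@lebesgue_measure R).
Implicit Types (k l : R -> R) (f : R -> \bar R).

(** Extended-real values let Tonelli apply to nonnegative data that may fail to be integrable, and
    let convolutions be iterated. *)
Definition convE k f (t : R) : \bar R := (\int[mu]_x ((k (t - x)%R)%:E * f x))%E.

Lemma measurable_subz : measurable_fun [set: R * R] (fun z => z.1 - z.2 : R).
Proof. exact: measurable_funB. Qed.

Lemma measurable_conv_integrand k f : measurable_fun [set: R] k ->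
  measurable_fun [set: R] f ->
  measurable_fun [set: R * R] (fun z => (k (z.1 - z.2)%R)%:E * f z.2)%E.
Proof.
move=> mk mf; apply: emeasurable_funM.
  apply/measurable_EFinP.
  exact: (measurableT_comp mk measurable_subz).
exact: (measurableT_comp mf measurable_snd).
Qed.

Section NonNegative.
Variables (k : R -> R) (f : R -> \bar R).
Hypotheses (mk : measurable_fun [set: R] k) (mf : measurable_fun [set: R] f).
Hypotheses (k0 : forall x, 0 <= k x) (f0 : forall x, (0 <= f x)%E).

Let integrand_ge0 (z : R * R) : (0 <= (k (z.1 - z.2)%R)%:E * f z.2)%E.
Proof. by rewrite mule_ge0// lee_fin. Qed.

Lemma convE_ge0 t : (0 <= convE k f t)%E.
Proof. by apply: integral_ge0 => x _; rewrite mule_ge0// lee_fin. Qed.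

Lemma measurable_convE : measurable_fun [set: R] (convE k f).
Proof.
have := @measurable_fun_fubini_tonelli_F _ _ _ _ _ mu _
  (measurable_conv_integrand mk mf) integrand_ge0.
exact.
Qed.

(** Tonelli and translation invariance. This turns a pointwise bound by a convolution into a
    contraction in L^1. *)
Lemma integral_convE :
  (\int[mu]_t convE k f t = \int[mu]_x (k x)%:E * \int[mu]_x f x)%E.
Proof.
have mkE : measurable_fun [set: R] (EFin \o k) by exact/measurable_EFinP.
rewrite /convE (@fubini_tonelli _ _ _ _ _ mu mu
  (fun z : R * R => (k (z.1 - z.2)%R)%:E * f z.2)%E)//=; last first.
  exact: measurable_conv_integrand.
have kint x : (\int[mu]_t (k (t - x))%:E = \int[mu]_t (k t)%:E)%E.
  rewrite [RHS](@ge0_integral_affine R 1 (- x) (EFin \o k))//.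
  by rewrite normr1 mul1e; under [RHS]eq_integral do rewrite /= mul1r.
have Ik0 : (0 <= \int[mu]_t (k t)%:E)%E.
  by apply: integral_ge0 => x _; rewrite lee_fin.
rewrite -ge0_integralZl//; apply: eq_integral => x _.
rewrite -(kint x); under eq_integral do rewrite muleC.
rewrite ge0_integralZl// 1?muleC//.
  apply/measurable_EFinP; apply: (measurableT_comp mk).
  exact: measurable_funB.
by move=> y _; rewrite lee_fin.
Qed.

End NonNegative.

Lemma convE_convE k l f (kl : R -> R -> R) t :
  measurable_fun [set: R] k -> measurable_fun [set: R] l ->
  measurable_fun [set: R] f ->
  (forall x, 0 <= k x) -> (forall x, 0 <= l x) -> (forall x, (0 <= f x)%E) ->
  (convE k (convE l f) t =
   \int[mu]_r ((\int[mu]_x (k (t - x) * l (x - r))%R%:E) * f r))%E.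
Proof.
move=> mk ml mf k0 l0 f0; rewrite /convE.
have mkt : measurable_fun [set: R] (fun x => k (t - x)).
  by apply: (measurableT_comp mk); exact: measurable_funB.
transitivity (\int[mu]_x \int[mu]_r ((k (t - x) * l (x - r))%R%:E * f r))%E.
  apply: eq_integral => x _; rewrite -ge0_integralZl//.
  - by apply: eq_integral => r _; rewrite EFinM muleA.
  - apply: emeasurable_funM => //; apply/measurable_EFinP.
    by apply: (measurableT_comp ml); exact: measurable_funB.
  - by move=> r _; rewrite mule_ge0// lee_fin.
  - by rewrite lee_fin.
rewrite (@fubini_tonelli _ _ _ _ _ mu mu
  (fun z : R * R => (k (t - z.1) * l (z.1 - z.2))%R%:E * f z.2)%E)//=; last 2 first.
  - apply: emeasurable_funM; last exact: (measurableT_comp mf measurable_snd).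
    apply/measurable_EFinP; apply: measurable_funM.
      exact: (measurableT_comp mkt measurable_fst).
    exact: (measurableT_comp ml measurable_subz).
  - by move=> z; rewrite mule_ge0// lee_fin mulr_ge0.
apply: eq_integral => r _; rewrite muleC -ge0_integralZl//.
- by apply: eq_integral => x _; rewrite muleC.
- apply/measurable_EFinP/measurable_funM => //.
  by apply: (measurableT_comp ml); exact: measurable_funB.
- by move=> x _; rewrite lee_fin mulr_ge0.
Qed.

End Convolution.

(** * Riesz kernels and the Beta function *)

Section RieszKernel.
Context {R : realType}.
Local Notation mu := (@lebesgue_measure R).
Implicit Types (s u t x d : R).

(** The Riemann-Liouville kernel without its Gamma factor, extended by 0 so that integrals over []0,
    t[] become convolutions on the line. *)
Definition rkernel s x : R := if 0 < x then x `^ (s - 1) else 0.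

Lemma rkernel_ge0 s x : 0 <= rkernel s x.
Proof. by rewrite /rkernel; case: ifP => // _; exact: powR_ge0. Qed.

Lemma rkernel_gt0E s x : 0 < x -> rkernel s x = x `^ (s - 1).
Proof. by rewrite /rkernel => ->. Qed.

Lemma rkernel_le0E s x : x <= 0 -> rkernel s x = 0.
Proof. by rewrite /rkernel leNgt => /negbTE ->. Qed.

Lemma measurable_rkernel s : measurable_fun [set: R] (rkernel s).
Proof.
by apply: measurable_fun_ifT; [exact: measurable_fun_ltr|
  exact: measurable_powR|exact: measurable_cst].
Qed.

Lemma rkernelM s c x : 0 < c -> rkernel s (c * x) = c `^ (s - 1) * rkernel s x.
Proof.
move=> c0; rewrite /rkernel pmulr_rgt0//.
by case: ifPn => x0; rewrite ?mulr0// powRM// ltW.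
Qed.

(** The full kernel has infinite mass on the line; the truncation is integrable and acts identically
    on time lags below [d]. *)
Definition trunc_rkernel d s x : R := if x < d then rkernel s x else 0.

Lemma trunc_rkernel_ge0 d s x : 0 <= trunc_rkernel d s x.
Proof. by rewrite /trunc_rkernel; case: ifP => // _; exact: rkernel_ge0. Qed.

Lemma measurable_trunc_rkernel d s : measurable_fun [set: R] (trunc_rkernel d s).
Proof.
by apply: measurable_fun_ifT; [exact: measurable_fun_ltr|
  exact: measurable_rkernel|exact: measurable_cst].
Qed.

Lemma integral_trunc_rkernel d s : 0 < s -> 0 <= d ->
  (\int[mu]_x (trunc_rkernel d s x)%:E = (d `^ s / s)%R%:E)%E.
Proof.
move=> s0 d0; rewrite -(integral_powR s0 d0) [RHS]integral_mkcond.
apply: eq_integral => x _; rewrite patchE mem_setE in_itv/=.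
rewrite /trunc_rkernel /rkernel; case: (ltP x d) => xd; rewrite ?andbF//.
by rewrite andbT; case: ifP.
Qed.

(** A power is monotone on [1/2, 1], so one of its end values bounds it; adding both covers either
    sign of [s - 1]. *)
Lemma powR_le_half s x : 1/2 <= x -> x <= 1 ->
  x `^ (s - 1) <= 1 + (1/2) `^ (s - 1).
Proof.
move=> x2 x1; have x0 : 0 < x by lra.
have [s1|s1] := leP 1 s.
  rewrite -[leLHS]addr0 lerD ?powR_ge0//.
  apply: (@le_trans _ _ (1 `^ (s - 1))); last by rewrite powR1.
  by apply: ge0_ler_powR; rewrite ?nnegrE ?subr_ge0//; lra.
rewrite -[leLHS]add0r lerD// -[s - 1]opprB 2!powRN lef_pV2 ?posrE ?powR_gt0//.
  by apply: ge0_ler_powR; rewrite ?nnegrE//; lra.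
Qed.

(** Euler's Beta integral, seen as the convolution of two kernels at time 1. *)
Definition Beta s u : R := fine (\int[mu]_x (rkernel s (1 - x) * rkernel u x)%:E).

Let beta_integrand_meas s u :
  measurable_fun [set: R] (fun x => (rkernel s (1 - x) * rkernel u x)%:E).
Proof.
apply/measurable_EFinP/measurable_funM; last exact: measurable_rkernel.
by apply: (measurableT_comp (measurable_rkernel _)); exact: measurable_funB.
Qed.

Let beta_integrand_ge0 s u x : (0 <= (rkernel s (1 - x) * rkernel u x)%:E)%E.
Proof. by rewrite lee_fin mulr_ge0 ?rkernel_ge0. Qed.

(** The two singularities lie at opposite ends: on each half of the unit interval one factor is
    bounded and the other integrable. *)
Lemma Beta_lty s u : 0 < s -> 0 < u ->
  (\int[mu]_x (rkernel s (1 - x) * rkernel u x)%:E < +oo)%E.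
Proof.
move=> s0 u0.
pose cs : R := 1 + (1/2) `^ (s - 1); pose cu : R := 1 + (1/2) `^ (u - 1).
have cs0 : 0 <= cs by rewrite addr_ge0 ?powR_ge0.
have cu0 : 0 <= cu by rewrite addr_ge0 ?powR_ge0.
have mtr c : measurable_fun [set: R] (fun x => (trunc_rkernel 1 c x)%:E).
  by apply/measurable_EFinP; exact: measurable_trunc_rkernel.
have mtr1 c : measurable_fun [set: R] (fun x => (trunc_rkernel 1 c (1 - x))%:E).
  apply: (measurableT_comp (mtr c)); exact: measurable_funB.
have t0 c x : (0 <= (trunc_rkernel 1 c x)%:E)%E.
  by rewrite lee_fin trunc_rkernel_ge0.
apply: (@le_lt_trans _ _ (\int[mu]_x (cs%:E * (trunc_rkernel 1 u x)%:E
   + cu%:E * (trunc_rkernel 1 s (1 - x))%:E))%E).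
  apply: ge0_le_integral => //.
  - exact: beta_integrand_meas.
  - by apply: emeasurable_funD; apply: measurable_funeM; [exact: mtr|exact: mtr1].
  - move=> x _; rewrite -!EFinM -EFinD lee_fin.
    have [x0|x0] := leP x 0.
      by rewrite (rkernel_le0E u x0) mulr0 addr_ge0 ?mulr_ge0 ?trunc_rkernel_ge0.
    have [x1|x1] := leP 1 x.
      rewrite (@rkernel_le0E s (1 - x)) ?subr_le0// mul0r.
      by rewrite addr_ge0 ?mulr_ge0 ?trunc_rkernel_ge0.
    rewrite /trunc_rkernel x1 gtrBl x0 !rkernel_gt0E ?subr_gt0//.
    have [x2|x2] := leP x (1/2).
      rewrite -[leLHS]addr0 lerD ?mulr_ge0 ?powR_ge0// ler_wpM2r ?powR_ge0//.
      by apply: powR_le_half; lra.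
    rewrite -[leLHS]add0r lerD ?mulr_ge0 ?powR_ge0// mulrC ler_wpM2r ?powR_ge0//.
    by apply: powR_le_half; lra.
rewrite ge0_integralD//; last first.
  - by apply: measurable_funeM; first [exact: mtr|exact: mtr1].
  - by move=> x _; rewrite mule_ge0// lee_fin.
  - by apply: measurable_funeM; first [exact: mtr|exact: mtr1].
  - by move=> x _; rewrite mule_ge0// lee_fin.
rewrite !ge0_integralZl//; last 2 first.
- exact: mtr1.
- exact: mtr.
rewrite integral_trunc_rkernel//.
have <- : (\int[mu]_x (trunc_rkernel 1 s x)%:E =
  \int[mu]_x (trunc_rkernel 1 s (1 - x))%:E)%E.
  rewrite (@ge0_integral_affine R (-1) 1 (EFin \o trunc_rkernel 1 s))//.
  - rewrite normrN1 mul1e; apply: eq_integral => x _ /=.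
    by rewrite mulN1r addrC.
  - exact: mtr.
  - exact: t0.
by rewrite integral_trunc_rkernel// ltry.
Qed.

Lemma EFin_Beta s u : 0 < s -> 0 < u ->
  (Beta s u)%:E = (\int[mu]_x (rkernel s (1 - x) * rkernel u x)%:E)%E.
Proof.
by move=> s0 u0; rewrite fineK// ge0_fin_numE ?Beta_lty// integral_ge0.
Qed.

Lemma Beta_gt0 s u : 0 < s -> 0 < u -> 0 < Beta s u.
Proof.
move=> s0 u0; apply: fine_gt0; rewrite Beta_lty// andbT.
(* On the unit interval x^(c - 1) >= x^c >= (1/4)^c, whatever the sign of [c - 1]. *)
have low c x : 0 < c -> 1/4 <= x -> x <= 1 -> (1/4) `^ c <= rkernel c x.
  move=> c0 x4 x1; have x0 : 0 < x by lra.
  rewrite rkernel_gt0E//; apply: (@le_trans _ _ (x `^ c)).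
    by apply: ge0_ler_powR; rewrite ?nnegrE; lra.
  by apply: ger_powR; rewrite ?x0//=; lra.
apply: (@lt_le_trans _ _ (\int[mu]_(x in `[(1/4)%R, (3/4)%R])
   ((1/4) `^ s * (1/4) `^ u)%R%:E)%E).
  rewrite integral_cst//= lebesgue_measure_itv/= lte_fin ifT; last by lra.
  rewrite -EFinB -EFinM lte_fin !mulr_gt0 ?powR_gt0//; lra.
rewrite [leLHS]integral_mkcond; apply: ge0_le_integral => //.
- by move=> x _; rewrite patchE; case: ifP => // _; rewrite lee_fin mulr_ge0 ?powR_ge0.
- by apply/(measurable_restrictT _ _).1 => //; exact: measurable_cst.
- exact: beta_integrand_meas.
- move=> x _; rewrite patchE; case: ifPn => // xI.
  move: xI; rewrite inE/= in_itv/= => /andP[x1 x2].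
  by rewrite lee_fin ler_pM ?powR_ge0// low//; lra.
Qed.

(** Mapping the unit interval affinely onto []r, t[] pulls a power of [t - r] out of each kernel;
    for [t <= r] the supports do not meet. *)
Lemma integral_rkernel_conv s u t r : 0 < s -> 0 < u ->
  (\int[mu]_x (rkernel s (t - x) * rkernel u (x - r))%:E =
   (Beta s u * rkernel (s + u) (t - r))%R%:E)%E.
Proof.
move=> s0 u0; have [tr|rt] := leP t r.
  rewrite (@rkernel_le0E _ (t - r)) ?subr_le0// mulr0.
  rewrite -[RHS](@integral0 _ _ _ mu setT); apply: eq_integral => x _.
  have [xr|rx] := leP x r; first by rewrite (@rkernel_le0E u) ?subr_le0// mulr0.
  by rewrite (@rkernel_le0E s) ?mul0r// subr_le0 ltW// (le_lt_trans tr).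
have c0 : 0 < t - r by rewrite subr_gt0.
rewrite (@ge0_integral_affine R (t - r) r (fun x =>
  (rkernel s (t - x) * rkernel u (x - r))%:E)) ?gt_eqF//; last 2 first.
- apply/measurable_EFinP/measurable_funM;
  by apply: (measurableT_comp (measurable_rkernel _)); exact: measurable_funB.
- by move=> x; rewrite lee_fin mulr_ge0 ?rkernel_ge0.
have E x : ((rkernel s (t - ((t - r) * x + r)) *
     rkernel u ((t - r) * x + r - r))%:E =
  ((t - r) `^ (s - 1) * (t - r) `^ (u - 1))%R%:E *
  (rkernel s (1 - x) * rkernel u x)%R%:E)%E.
  rewrite addrK (_ : t - _ = (t - r) * (1 - x)); last by ring.
  by rewrite !rkernelM// -EFinM; congr EFin; ring.
under eq_integral do rewrite E.
rewrite ge0_integralZl//; first last.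
- by rewrite lee_fin mulr_ge0 ?powR_ge0.
- exact: beta_integrand_meas.
rewrite (rkernel_gt0E _ c0) gtr0_norm// [RHS]EFinM EFin_Beta// muleA.
rewrite [RHS]muleC -EFinM; congr (_%:E * _)%E.
rewrite -powRD; last by rewrite (gt_eqF c0) implybT.
rewrite -[X in X * _](@powRr1 _ (t - r)) ?ltW// -powRD; last first.
  by rewrite (gt_eqF c0) implybT.
by congr (_ `^ _); ring.
Qed.

End RieszKernel.

(** * Real-valued convolution and Young's inequality in L^1 *)

Section RealConvolution.
Context {R : realType}.
Local Notation mu := (@lebesgue_measure R).
Implicit Types (k u : R -> R) (t T : R).

Definition conv k u t : R := \int[mu]_x (k (t - x) * u x).

Lemma measurable_conv_real k u : measurable_fun [set: R] k ->
  measurable_fun [set: R] u ->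
  measurable_fun [set: R * R] (fun z => (k (z.1 - z.2) * u z.2)%:E).
Proof.
move=> mk m_u; apply/measurable_EFinP; apply: measurable_funM.
  exact: (measurableT_comp mk measurable_subz).
exact: (measurableT_comp m_u measurable_snd).
Qed.

(** This includes the times at which the integral diverges: Tonelli handles the positive and the
    negative part separately, and [fine] is measurable. *)
Lemma measurable_conv k u : measurable_fun [set: R] k ->
  measurable_fun [set: R] u -> measurable_fun [set: R] (conv k u).
Proof.
move=> mk m_u; apply: (measurableT_comp (@fine_measurable R _ measurableT)).
under eq_fun do rewrite integralE.
have mz := measurable_conv_real mk m_u.
pose f (z : R * R) := (k (z.1 - z.2) * u z.2)%:E.
apply: emeasurable_funB.
  have := @measurable_fun_fubini_tonelli_F _ _ _ _ _ mu (f^\+)%E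
    (measurable_funepos mz) (fun z => funepos_ge0 f z).
  rewrite (_ : fubini_F _ _ = fun x : R => (\int[mu]_y
    (fun y : R => (k (x - y) * u y)%R%:E)^\+%E y)%E)//.
  by apply/funext => x; apply: eq_integral => y _; rewrite !funeposE.
have := @measurable_fun_fubini_tonelli_F _ _ _ _ _ mu (f^\-)%E
  (measurable_funeneg mz) (fun z => funeneg_ge0 f z).
rewrite (_ : fubini_F _ _ = fun x : R => (\int[mu]_y
  (fun y : R => (k (x - y) * u y)%R%:E)^\-%E y)%E)//.
by apply/funext => x; apply: eq_integral => y _; rewrite !funenegE.
Qed.

Section L1.
Variables k u : R -> R.
Hypotheses (ik : mu.-integrable [set: R] (EFin \o k))
           (iu : mu.-integrable [set: R] (EFin \o u)).

Let mk : measurable_fun [set: R] k.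
Proof. by apply/measurable_EFinP; exact: measurable_int ik. Qed.
Let m_u : measurable_fun [set: R] u.
Proof. by apply/measurable_EFinP; exact: measurable_int iu. Qed.

(** Tonelli on absolute values: the double integral is the product of the two L^1 norms. *)
Lemma integrable_conv_integrand : (mu \x mu)%E.-integrable [set: R * R]
  (fun z => (k (z.1 - z.2) * u z.2)%:E).
Proof.
apply/integrable12ltyP; first exact: measurable_conv_real.
have -> : (\int[mu]_x \int[mu]_y `|(k (x - y) * u y)%R%:E| =
  \int[mu]_x convE (fun y => `|k y|%R) (fun y => `|u y|%:E) x)%E.
  by apply: eq_integral => x _; apply: eq_integral => y _; rewrite -EFinM -normrM.
rewrite integral_convE//.
- case/integrableP: ik => _ ik'; case/integrableP: iu => _ iu'.
  apply: lte_mul_pinfty => //; first exact: integral_ge0.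
  by rewrite ge0_fin_numE// integral_ge0.
- exact: measurableT_comp.
- by apply/measurable_EFinP; exact: measurableT_comp.
Qed.

Lemma ae_integrable_conv :
  {ae mu, forall t, mu.-integrable [set: R] (fun x => (k (t - x) * u x)%:E)}.
Proof. exact: (ae_integrable1 integrable_conv_integrand). Qed.

Lemma integrable_conv : mu.-integrable [set: R] (EFin \o conv k u).
Proof.
have := integrable_fubini_F integrable_conv_integrand.
apply: le_integrable => //.
  by apply/measurable_EFinP; exact: measurable_conv.
move=> x _; rewrite /conv /Rintegral /fubini_F/=.
by case: integral => //= *; rewrite ?leey.
Qed.

End L1.

End RealConvolution.

(** * Fractional integrals *)

Section FractionalIntegral.
Context {R : realType}.
Local Notation mu := (@lebesgue_measure R).
Implicit Types (u v : R -> R) (s t T a b : R).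

Definition frac_int a u t : R :=
  \int[mu]_(s in `]0, t[) ((t - s) `^ (a - 1) * u s).

Lemma frac_int_integrandE a u t T : t <= T ->
  (fun s => (t - s) `^ (a - 1) * u s) \_ `]0, t[ =
  (fun s => rkernel a (t - s) * (u \_ `]0, T[) s).
Proof.
move=> tT; apply/funext => s; rewrite !patchE !mem_setE !in_itv/=.
case: (ltP 0 s) => s0; rewrite ?mulr0//.
case: (ltP s t) => st; rewrite ?andbT ?andbF.
  by rewrite (lt_le_trans st tT) rkernel_gt0E// subr_gt0.
by rewrite rkernel_le0E ?subr_le0// mul0r.
Qed.

(** One restriction to []0, T[] serves all [t <= T], so the results on a single convolution apply to
    the whole time range. *)
Lemma frac_intE a u t T : t <= T ->
  frac_int a u t = conv (rkernel a) (u \_ `]0, T[) t.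
Proof.
by move=> tT; rewrite /frac_int Rintegral_mkcond (frac_int_integrandE _ _ tT).
Qed.

Lemma integrable_restrict D u : measurable D ->
  mu.-integrable D (EFin \o u) -> mu.-integrable [set: R] (EFin \o u \_ D).
Proof.
by move=> mD iu; rewrite -restrict_EFin; apply/(integrable_mkcond _ mD).
Qed.

Lemma integrable_trunc_rkernel a T : 0 < a -> 0 < T ->
  mu.-integrable [set: R] (EFin \o trunc_rkernel T a).
Proof.
move=> a0 T0; apply/integrableP; split.
  by apply/measurable_EFinP; exact: measurable_trunc_rkernel.
rewrite (_ : (\int[mu]_x _)%E = (\int[mu]_x (trunc_rkernel T a x)%:E)%E).
  by rewrite integral_trunc_rkernel ?ltW// ltry.
by apply: eq_integral => x _; rewrite /= ger0_norm// trunc_rkernel_ge0.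
Qed.

Lemma rkernel_trunc a u t T x : t <= T ->
  rkernel a (t - x) * (u \_ `]0, T[) x =
  trunc_rkernel T a (t - x) * (u \_ `]0, T[) x.
Proof.
move=> tT; rewrite patchE mem_setE in_itv/=; case: ifPn => [/andP[x0 _]|_].
  by rewrite /trunc_rkernel ifT// ltrBlDr (le_lt_trans tT)// ltrDl.
by rewrite !mulr0.
Qed.

Section Integrable.
Variables (a T : R) (u : R -> R).
Hypotheses (a0 : 0 < a) (T0 : 0 < T).
Hypothesis iu : mu.-integrable `]0, T[ (EFin \o u).

Let iu0 := integrable_restrict (measurable_itv _) iu.

Lemma integrable_frac_int : mu.-integrable `]0, T[ (EFin \o frac_int a u).
Proof.
have h := integrable_conv (integrable_trunc_rkernel a0 T0) iu0.
apply: eq_integrable (integrableS measurableT _ _ h) => //.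
move=> t; rewrite inE/= in_itv/= => /andP[_ tT].
rewrite (frac_intE _ _ (ltW tT)) /conv; congr EFin.
by apply: eq_Rintegral => x _; rewrite (rkernel_trunc _ _ _ (ltW tT)).
Qed.

Lemma ae_integrable_frac_int : {ae mu, forall t, t < T ->
  mu.-integrable [set: R]
   (fun x => (rkernel a (t - x) * (u \_ `]0, T[) x)%:E)}.
Proof.
have := ae_integrable_conv (integrable_trunc_rkernel a0 T0) iu0.
apply: filterS; first exact: (ae_filter_ringOfSetsType mu).
move=> t it tT; apply: eq_integrable it => // x _.
by rewrite (rkernel_trunc _ _ _ (ltW tT)).
Qed.

End Integrable.

(** The semigroup law, by Fubini. With [1 <= a + b] the composed kernel is bounded by t^(a + b - 1)
    on []0, t[], so the law holds at every [t] and not just almost everywhere. *)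
Lemma frac_int_comp a b u t : 0 < a -> 0 < b -> 1 <= a + b -> 0 < t ->
  mu.-integrable `]0, t[ (EFin \o u) ->
  frac_int a (frac_int b u) t = Beta a b * frac_int (a + b) u t.
Proof.
move=> a0 b0 ab1 t0 iu.
have iu0 := integrable_restrict (measurable_itv _) iu.
set u0 := u \_ _ in iu0.
have mu0 : measurable_fun [set: R] u0.
  by apply/measurable_EFinP; exact: measurable_int iu0.
pose k := rkernel a; pose l := rkernel b.
pose f (z : R * R) := (k (t - z.1) * l (z.1 - z.2) * u0 z.2)%:E.
have mkt : measurable_fun [set: R] (fun x => k (t - x)).
  apply: (measurableT_comp (measurable_rkernel a)); exact: measurable_funB.
have mf : measurable_fun [set: R * R] f.
  apply/measurable_EFinP/measurable_funM.
    apply: measurable_funM; first exact: (measurableT_comp mkt measurable_fst).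
    exact: (measurableT_comp (measurable_rkernel b) measurable_subz).
  exact: (measurableT_comp mu0 measurable_snd).
have ik : mu.-integrable [set: R] (fun r =>
    (Beta a b * rkernel (a + b) (t - r) * u0 r)%:E).
  have mk : measurable_fun [set: R] (fun r => rkernel (a + b) (t - r)).
    apply: (measurableT_comp (measurable_rkernel _)); exact: measurable_funB.
  have := integrableZl measurableT (Beta a b * t `^ (a + b - 1)) iu0.
  apply: le_integrable => //.
    apply/measurable_EFinP/measurable_funM => //.
    by apply: measurable_funM => //; exact: measurable_cst.
  move=> r _; rewrite -EFinM !abse_EFin lee_fin !normrM.
  have [r0|r0] := leP r 0.
    by rewrite /u0 patchE mem_setE in_itv/= ltNge r0 normr0 !mulr0.
  rewrite ler_wpM2r// ler_wpM2l// [leLHS]ger0_norm ?rkernel_ge0//.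
  rewrite ger0_norm ?powR_ge0//; have [tr|tr] := leP t r.
    by rewrite rkernel_le0E ?subr_le0// powR_ge0.
  rewrite rkernel_gt0E ?subr_gt0//.
  apply: ge0_ler_powR; rewrite ?nnegrE; lra.
have int_f : (mu \x mu)%E.-integrable [set: R * R] f.
  apply/integrable12ltyP => //.
  have -> : (\int[mu]_x \int[mu]_y `|f (x, y)| =
     convE k (convE l (fun y => `|u0 y|%:E)) t)%E.
    apply: eq_integral => x _; rewrite /convE -ge0_integralZl//.
    - apply: eq_integral => y _; rewrite /f/= !normrM.
      by rewrite !(@ger0_norm _ (rkernel _ _)) ?rkernel_ge0// !EFinM muleA.
    - apply: emeasurable_funM; apply/measurable_EFinP; last exact: measurableT_comp.
      by apply: (measurableT_comp (measurable_rkernel b)); exact: measurable_funB.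
    - by move=> y _; rewrite mule_ge0// lee_fin ?rkernel_ge0.
    - by rewrite lee_fin rkernel_ge0.
  rewrite (convE_convE (fun _ => k))//; last 5 first.
  - exact: measurable_rkernel.
  - exact: measurable_rkernel.
  - by apply/measurable_EFinP; exact: measurableT_comp.
  - exact: rkernel_ge0.
  - exact: rkernel_ge0.
  case/integrableP: ik => _; apply: le_lt_trans.
  rewrite le_eqVlt; apply/orP; left; apply/eqP; apply: eq_integral => r _.
  rewrite integral_rkernel_conv// -EFinM; congr EFin; rewrite !normrM.
  by rewrite (gtr0_norm (Beta_gt0 a0 b0)) (ger0_norm (rkernel_ge0 _ _)).
have fub := Fubini int_f.
rewrite (frac_intE _ _ (lexx t)) (frac_intE (a + b) u (lexx t)) -/u0.
transitivity (fine (\int[mu]_x \int[mu]_y f (x, y))%E).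
  congr fine; apply: ae_eq_integral => //.
  - apply/measurable_EFinP/measurable_funM => //.
    apply/(measurable_restrictT _ _).1 => //.
    apply: (@eq_measurable_fun _ _ _ _ _ (conv l u0)).
      move=> s; rewrite inE/= in_itv/= => /andP[_ /ltW st].
      by rewrite (frac_intE _ _ st).
    by apply: measurable_funTS; apply: measurable_conv => //; exact: measurable_rkernel.
  (* It remains to identify the inner integrals for almost every [s], those at which [f (s, _)] is
     integrable. *)
  - exact: (measurable_fubini_F int_f).
  have := ae_integrable1 int_f.
  apply: (@filterS _ _ (ae_filter_ringOfSetsType mu)).
  move=> s ifs _.
  have [st|st] := leP t s.
    rewrite /f rkernel_le0E ?subr_le0// mul0r.
    rewrite -[LHS](@integral0 _ _ _ mu setT); apply: eq_integral => r _.
    by rewrite /f/= /k rkernel_le0E ?subr_le0// !mul0r.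
  have [s0|s0] := leP s 0.
    rewrite patchE mem_setE in_itv/= ltNge s0 mulr0.
    rewrite -[LHS](@integral0 _ _ _ mu setT); apply: eq_integral => r _.
    rewrite /f/= /u0 patchE mem_setE in_itv/=.
    case: ifPn; rewrite ?mulr0// => /andP[r0 _].
    rewrite /l rkernel_le0E; last by rewrite subr_le0 (le_trans s0)// ltW.
    by rewrite mulr0 mul0r.
  (* Dividing by this factor recovers the integrability of the inner convolution from that of
     [f (s, _)]. *)
  have kts : k (t - s) != 0.
    by rewrite /k rkernel_gt0E ?subr_gt0// gt_eqF// powR_gt0// subr_gt0.
  rewrite patchE mem_setE in_itv/= s0 st (frac_intE _ _ (ltW st)) -/u0 EFinM.
  have ifs' : mu.-integrable [set: R] (fun r => (l (s - r) * u0 r)%:E).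
    have := integrableZl measurableT (k (t - s))^-1 ifs.
    apply: eq_integrable => // r _; rewrite /f/= -EFinM; congr EFin.
    by rewrite !mulrA mulVf// mul1r.
  rewrite /conv /Rintegral fineK; last exact: integrable_fin_num.
  rewrite -integralZl//; apply: eq_integral => r _.
  by rewrite /f/= -EFinM mulrA.
rewrite fub.
transitivity (fine (\int[mu]_r (Beta a b * rkernel (a + b) (t - r) * u0 r)%:E)).
  congr fine; apply: eq_integral => r _.
  rewrite [RHS]EFinM -integral_rkernel_conv//.
  have ir : mu.-integrable [set: R]
     (fun x => (rkernel a (t - x) * rkernel b (x - r))%:E).
    apply/integrableP; split.
      apply/measurable_EFinP/measurable_funM => //.
      by apply: (measurableT_comp (measurable_rkernel b)); exact: measurable_funB.
    rewrite (_ : integral _ _ _ = \int[mu]_x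
       (rkernel a (t - x) * rkernel b (x - r))%:E)%E.
      by rewrite integral_rkernel_conv// ltry.
    by apply: eq_integral => x _; rewrite abse_EFin ger0_norm// mulr_ge0 ?rkernel_ge0.
  rewrite muleC -integralZl//; apply: eq_integral => x _.
  by rewrite /f/= -EFinM mulrC.
rewrite /conv /Rintegral.
have ik' : mu.-integrable [set: R] (fun r => (rkernel (a + b) (t - r) * u0 r)%:E).
  have := integrableZl measurableT (Beta a b)^-1 ik.
  apply: eq_integrable => // r _; rewrite -EFinM; congr EFin.
  by rewrite !mulrA mulVf ?mul1r// gt_eqF// Beta_gt0.
rewrite -[RHS]/(fine (Beta a b)%:E * _) -fineM//; last exact: integrable_fin_num.
rewrite -integralZl//; congr fine; apply: eq_integral => r _.
by rewrite -EFinM mulrA.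
Qed.

End FractionalIntegral.

(** * Integrals and null sets *)

Section NullSets.
Import HBNNSimple.
Context d (T : measurableType d) (R : realType).
Variable mu : {measure set T -> \bar R}.

(** The integral is a supremum over simple functions below [f]. Cutting such a function off on the
    exceptional null set keeps its integral and puts it below [g]. *)
Let le_integral_ae (f g : T -> \bar R) :
  (forall x, 0 <= f x)%E -> (forall x, 0 <= g x)%E ->
  {ae mu, forall x, f x = g x} -> (\int[mu]_x f x <= \int[mu]_x g x)%E.
Proof.
move=> f0 g0 [A [mA A0 fgA]]; rewrite !ge0_integralTE//.
apply: ge_ereal_sup => _ [h hf <-].
pose h' := mul_nnsfun h (indic_nnsfun R (measurableC mA)).
suff -> : sintegral mu h = sintegral mu h'.
  apply: ereal_sup_ubound; exists h' => // x.
  change ((h x * \1_(~` A) x)%:E <= g x)%E; rewrite indicE.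
  case: (boolP (x \in ~` A)) => [|xA]; last by rewrite mulr0.
  rewrite mulr1 inE /= => nAx; rewrite (le_trans (hf x))//.
  have -> // : f x = g x by apply: contrapT => fg; exact/nAx/fgA.
rewrite -!integralT_nnsfun; apply: ge0_ae_eq_integral => //.
- exact/measurable_EFinP/measurable_funP.
- exact/measurable_EFinP/measurable_funP.
- by move=> x _; rewrite lee_fin.
- by move=> x _; rewrite lee_fin.
exists A; split => // x /=; apply: contra_notP => nAx _.
change ((h x)%:E = (h x * \1_(~` A) x)%:E).
by rewrite indicE mem_set ?mulr1.
Qed.

(* Neither function is assumed measurable: the derivative of a price path is
   only known to coincide almost everywhere with a measurable function. *)
Lemma integral_eq_ae (D : set T) (f g : T -> \bar R) :
  {ae mu, forall x, D x -> f x = g x} ->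
  (\int[mu]_(x in D) f x = \int[mu]_(x in D) g x)%E.
Proof.
move=> fg; rewrite [LHS]integral_mkcond [RHS]integral_mkcond.
have fgD : {ae mu, forall x, (f \_ D) x = (g \_ D) x}.
  apply: filterS fg => x fgx; rewrite !patchE; case: ifPn => //.
  by rewrite inE => /fgx.
rewrite [LHS]integralE [RHS]integralE; congr (_ - _)%E.
  apply/eqP; rewrite eq_le; apply/andP; split; apply: le_integral_ae => //;
  by apply: filterS fgD => x; rewrite !funeposE => ->.
apply/eqP; rewrite eq_le; apply/andP; split; apply: le_integral_ae => //;
by apply: filterS fgD => x; rewrite !funenegE => ->.
Qed.

End NullSets.

(** * Variation of absolutely continuous functions *)

Section IntervalFamilies.
Context {R : realType}.
Implicit Types (s r : seq (R * R)) (p q : R * R) (u v x y : R).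

Definition non_overlapping : rel (R * R) :=
  [rel p q | (p.2 <= q.1) || (q.2 <= p.1)].

(** The families of absolute continuity as lists of end points, easy to cut and concatenate.
    Intervals may touch or be degenerate. *)
Definition itv_family s :=
  all [pred p : R * R | p.1 <= p.2] s && pairwise non_overlapping s.

(** With [Num.min _ u] or [Num.max _ u] for [h] this cuts a family at [u]; intervals on the wrong
    side collapse to [u] instead of being dropped. *)
Definition map_ends (h : R -> R) p : R * R := (h p.1, h p.2).

Lemma non_overlapping_sym : symmetric non_overlapping.
Proof. by move=> p q; rewrite /non_overlapping/= orbC. Qed.

Lemma itv_family_map h s : {homo h : x y / x <= y} ->
  itv_family s -> itv_family [seq map_ends h p | p <- s].
Proof.
move=> hh /andP[s1 s2]; apply/andP; split.
  by rewrite all_map; apply: sub_all s1 => p /= /hh.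
rewrite pairwise_map; apply: sub_pairwise s2 => p q /= /orP[|] /hh pq.
  by apply/orP; left.
by apply/orP; right.
Qed.

Lemma homo_minr u : {homo (fun x => Num.min x u) : x y / x <= y}.
Proof. by move=> x y xy; rewrite le_min !ge_min xy lexx !orbT. Qed.

Lemma homo_maxr u : {homo (fun x => Num.max x u) : x y / x <= y}.
Proof. by move=> x y xy; rewrite ge_max !le_max xy lexx !orbT. Qed.

Definition total_length s := \sum_(p <- s) (p.2 - p.1).

(** Every other interval lies on one side of [p], so cutting at the ends of [p] leaves two families
    in disjoint ranges. The induction is on the size, since both are images of the tail. *)
Lemma total_length_within n u v s : size s = n -> u <= v -> itv_family s ->
  all [pred p : R * R | (u <= p.1) && (p.2 <= v)] s -> total_length s <= v - u.
Proof.
elim: n u v s => [|n ih] u v [|p s]//=; rewrite /total_length.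
  by move=> _ uv _ _; rewrite big_nil subr_ge0.
move=> [sn] uv /andP[/= /andP[p12 s12] /andP[ps ss]] /andP[/andP[up pv] suv].
rewrite big_cons/=.
pose s1 := [seq map_ends (fun x => Num.min x p.1) q | q <- s].
pose s2 := [seq map_ends (fun x => Num.max x p.2) q | q <- s].
have fs : itv_family s by rewrite /itv_family s12.
have l1 : total_length s1 <= p.1 - u.
  apply: ih; rewrite ?size_map//; first exact: itv_family_map (@homo_minr _) fs.
  rewrite all_map; apply: sub_all suv => q /= /andP[uq _].
  by rewrite le_min uq up ge_min lexx orbT.
have l2 : total_length s2 <= v - p.2.
  apply: ih; rewrite ?size_map//; first exact: itv_family_map (@homo_maxr _) fs.
  rewrite all_map; apply: sub_all suv => q /= /andP[_ qv].
  by rewrite le_max lexx orbT ge_max qv pv.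
suff -> : \sum_(q <- s) (q.2 - q.1) = total_length s1 + total_length s2 by lra.
rewrite /total_length !big_map -big_split/=.
apply: eq_big_seq => q qs /=.
move/allP: ps => /(_ _ qs)/= pq; move/allP: s12 => /(_ _ qs)/= q12.
case/orP: pq => h.
- rewrite (min_idPr (le_trans p12 h)) (min_idPr (le_trans (le_trans p12 h) q12)).
  by rewrite (max_idPl h) (max_idPl (le_trans h q12)); ring.
- rewrite (min_idPl h) (min_idPl (le_trans q12 h)).
  by rewrite (max_idPr (le_trans h p12)) (max_idPr (le_trans (le_trans q12 h) p12)); ring.
Qed.

Definition variation_on (F : R -> R) s := \sum_(p <- s) `|F p.2 - F p.1|.

Lemma variation_on_split F u s : itv_family s ->
  variation_on F s <=
  variation_on F [seq map_ends (fun x => Num.min x u) p | p <- s] +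
  variation_on F [seq map_ends (fun x => Num.max x u) p | p <- s].
Proof.
move=> /andP[/allP s12 _]; rewrite /variation_on !big_map -big_split/=.
rewrite big_seq [leRHS]big_seq; apply: ler_sum => p /s12 /= p12.
have [u1|u1] := leP u p.1.
  rewrite (min_idPr (le_trans u1 p12)) (max_idPl (le_trans u1 p12)).
  by rewrite subrr normr0 add0r.
have [u2|u2] := leP u p.2.
  by rewrite -[F p.2 - F p.1](subrKA (F u)) addrC ler_normD.
by rewrite subrr normr0 addr0.
Qed.

End IntervalFamilies.

(** * The variation function and its absolute continuity *)

Section Variation.
Context {R : realType}.
Implicit Types (F : R -> R) (s r : seq (R * R)) (u v x y T : R).

Definition small_variation F := forall eps : R, 0 < eps ->
  exists2 delta : R, 0 < delta & forall s, itv_family s ->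
    total_length s < delta -> variation_on F s < eps.

(** Composing with it extends a function on [0, T] to the line by constants, which adds no
    variation. *)
Definition clamp T x : R := Num.max 0 (Num.min x T).

Lemma homo_clamp T : {homo clamp T : x y / x <= y}.
Proof.
by move=> x y xy; rewrite /clamp ge_max !le_max lexx/= homo_minr ?orbT.
Qed.

Lemma clamp_id T x : 0 <= x -> x <= T -> clamp T x = x.
Proof. by move=> x0 xT; rewrite /clamp (min_idPl xT) (max_idPr x0). Qed.

Lemma clampB T x y : 0 <= T -> x <= y -> clamp T y - clamp T x <= y - x.
Proof.
move=> T0 xy; rewrite /clamp.
case: (leP x T) => ?; case: (leP y T) => ?;
  repeat match goal with |- context [Num.max 0 ?z] => case: (leP 0 z) => ? end; lra.
Qed.

Lemma small_variation_clamp T F : 0 <= T -> absolutely_continuous_on 0 T F ->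
  small_variation (F \o clamp T).
Proof.
move=> T0 acF eps /acF[delta d0 acd]; exists delta => // s fs lens.
pose c := [seq map_ends (clamp T) p | p <- s].
have /andP[c12 cc] : itv_family c by exact: itv_family_map (@homo_clamp T) fs.
pose pt (i : 'I_(size c)) := nth (0, 0) c i.
have ptc i : pt i \in c by rewrite mem_nth.
have := acd _ (fun i => (pt i).1) (fun i => (pt i).2).
have sumE (f : R * R -> R) : \sum_(i < size c) f (pt i) = \sum_(p <- c) f p.
  by rewrite (big_nth (0, 0)) big_mkord.
rewrite (sumE (fun p => `|F p.2 - F p.1|)) (sumE (fun p => p.2 - p.1)).
rewrite /c !big_map; apply.
- move=> i; have /mapP[p ps ->] := ptc i.
  split; first by rewrite /= /clamp le_max lexx.
  split; last by rewrite /= /clamp ge_max T0 ge_min lexx orbT.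
  by move/andP: fs => [/allP/(_ _ ps)/= h _]; exact: homo_clamp.
- apply/trivIsetP => i j _ _ ij.
  have no : non_overlapping (pt i) (pt j).
    have [/= ij'|/= ji|/val_inj/eqP] := ltngtP (val i) (val j);
      last by rewrite (negbTE ij).
      by apply: (pairwiseP (0, 0) cc); rewrite ?inE.
    by rewrite non_overlapping_sym; apply: (pairwiseP (0, 0) cc); rewrite ?inE.
  rewrite -subset0 => x /=; rewrite !in_itv/= => -[/andP[a b] /andP[e f]].
  by move: no => /orP[|] ?; lra.
- apply: le_lt_trans lens.
  rewrite /total_length big_seq [leRHS]big_seq; apply: ler_sum => p ps.
  by apply: clampB => //; move/andP: fs => [/allP/(_ _ ps)].
Qed.

Lemma itv_family_cat s r : itv_family (s ++ r) =
  [&& itv_family s, itv_family r & allrel non_overlapping s r].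
Proof.
rewrite /itv_family all_cat pairwise_cat.
by do !case: (all _ _); do !case: (pairwise _ _); rewrite ?andbT ?andbF.
Qed.

Lemma variation_on_cat F s r :
  variation_on F (s ++ r) = variation_on F s + variation_on F r.
Proof. by rewrite /variation_on big_cat. Qed.

Lemma total_length_cat s r : total_length (s ++ r) = total_length s + total_length r.
Proof. by rewrite /total_length big_cat. Qed.

Section TotalVariation.
Variables (F : R -> R) (T : R).
Hypotheses (svF : small_variation F)
  (F0 : forall x, x <= 0 -> F x = F 0) (FT : forall x, T <= x -> F x = F T).

(** Cut [0, T] into windows shorter than the [delta] belonging to 1: each contributes at most 1, and
    nothing is contributed outside [0, T]. *)
Lemma variation_on_bounded : exists M, forall s, itv_family s -> variation_on F s <= M.
Proof.
have [delta d0 svd] := svF ltr01; pose h := delta / 2.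
have h0 : 0 < h by rewrite divr_gt0.
(* The induction removes the last window by cutting at [n%:R * h]. *)
have below n s : itv_family s -> all [pred p : R * R | p.2 <= n%:R * h] s ->
    variation_on F s <= n%:R.
  elim: n s => [|n ih] s fs sn.
    rewrite mul0r in sn; rewrite /variation_on big_seq big1// => p ps.
    move/allP: sn => /(_ _ ps)/= p0; move/andP: fs => [/allP/(_ _ ps)/= p12 _].
    by rewrite F0// [F p.1]F0 ?(le_trans p12)// subrr normr0.
  apply: (le_trans (variation_on_split F (n%:R * h) fs)).
  rewrite -natr1 lerD//.
    apply: ih; first exact: itv_family_map (@homo_minr _ _) fs.
    by rewrite all_map; apply/allP => p _ /=; rewrite ge_min lexx orbT.
  apply/ltW/svd; first exact: itv_family_map (@homo_maxr _ _) fs.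
  apply: (@le_lt_trans _ _ h); last by rewrite /h; lra.
  rewrite [leRHS](_ : _ = n.+1%:R * h - n%:R * h); last by rewrite -natr1; ring.
  apply: (total_length_within erefl).
  - by rewrite ler_wpM2r ?ltW// ltr_nat.
  - exact: itv_family_map (@homo_maxr _ _) fs.
  - rewrite all_map; apply: sub_all sn => p /= pn.
    by rewrite le_max lexx orbT/= ge_max pn ler_wpM2r ?ltW// ltr_nat.
exists (Num.truncn (T / h)).+1%:R => s fs.
pose N := (Num.truncn (T / h)).+1.
have TN : T <= N%:R * h.
  by rewrite -ler_pdivrMr// ltW// truncnS_gt// divr_ge0// ltW.
have -> : variation_on F s =
    variation_on F [seq map_ends (fun x => Num.min x T) p | p <- s].
  rewrite /variation_on big_map; apply: eq_bigr => p _ /=.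
  have E x : F (Num.min x T) = F x by case: (leP x T) => // /ltW/FT.
  by rewrite !E.
apply: below; first exact: itv_family_map (@homo_minr _ _) fs.
rewrite all_map; apply/allP => p _ /=.
by apply: le_trans TN; rewrite ge_min lexx orbT.
Qed.

Let below x := [set variation_on F s | s in
  [set s | itv_family s /\ all [pred p : R * R | p.2 <= x] s]].

(** The total variation over ]-oo, x]. Subtracting [F] from it gives the Jordan decomposition. *)
Definition var_below x : R := sup (below x).

Let has_sup_below x : has_sup (below x).
Proof.
split; first by exists 0, [::]; [|rewrite /variation_on big_nil].
by have [M bM] := variation_on_bounded; exists M => _ [s [fs _] <-]; exact: bM.
Qed.

Lemma var_below_ge s x : itv_family s -> all [pred p : R * R | p.2 <= x] s ->
  variation_on F s <= var_below x.
Proof.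
move=> fs sx; apply: ub_le_sup; first by have [] := has_sup_below x.
by exists s.
Qed.

Lemma var_below_le x M : (forall s, itv_family s ->
  all [pred p : R * R | p.2 <= x] s -> variation_on F s <= M) -> var_below x <= M.
Proof.
move=> h; apply: ge_sup; first by have [] := has_sup_below x.
by move=> _ [s [fs sx] <-]; exact: h.
Qed.

(** Append [(x, y)] to any family below [x]. Hence [var_below] and its difference with [F] are both
    nondecreasing. *)
Lemma var_below_incr x y : x <= y -> `|F y - F x| <= var_below y - var_below x.
Proof.
move=> xy; rewrite lerBrDl -lerBrDr; apply: var_below_le => s fs sx.
rewrite lerBrDr.
have -> : variation_on F s + `|F y - F x| = variation_on F (s ++ [:: (x, y)]).
  by rewrite variation_on_cat /variation_on big_seq1.
apply: var_below_ge.
  rewrite itv_family_cat fs/= /itv_family/= xy/= allrel1r.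
  by apply: sub_all sx => p /= px; apply/orP; left.
rewrite all_cat /= lexx !andbT; apply: sub_all sx => p /= px.
exact: le_trans xy.
Qed.

(** An increment of the variation function is approached by variations of families inside the
    interval. Replacing all intervals by such families yields one family of no larger total length,
    to which the smallness of [F] applies. *)
Lemma var_below_small eps : 0 < eps -> exists2 delta : R, 0 < delta &
  forall s, itv_family s -> total_length s < delta ->
    \sum_(p <- s) (var_below p.2 - var_below p.1) <= eps.
Proof.
move=> /svF[delta d0 svd]; exists delta => // s fs ls.
(* [r] collects the subfamilies that have already replaced their intervals. *)
suff : forall r, itv_family (s ++ r) -> total_length (s ++ r) < delta ->
    \sum_(p <- s) (var_below p.2 - var_below p.1) + variation_on F r <= eps.
  move=> /(_ [::]); rewrite cats0 => /(_ fs ls).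
  by rewrite /variation_on big_nil addr0.
elim: s {fs ls} => [|p s ih] r fsr lsr.
  by rewrite big_nil add0r ltW// svd.
move: fsr; rewrite itv_family_cat => /and3P[fps fr].
have /andP[/=/andP[p12 s12] /andP[/allP ps ss]] := fps.
rewrite allrel_consl => /andP[/allP pr sr].
have fs : itv_family s by rewrite /itv_family s12.
rewrite big_cons -addrA addrAC -lerBrDr -lerBrDr; apply: var_below_le => c fc cv.
(* The part of [c] left of [p.1] is paid for by [var_below p.1]; the part inside [p] is moved into
   [r]. *)
apply: (le_trans (variation_on_split F p.1 fc)).
set c1 := map _ c; set c2 := map _ c.
have c1u : variation_on F c1 <= var_below p.1.
  apply: var_below_ge; first exact: itv_family_map (@homo_minr _ _) fc.
  by rewrite all_map; apply/allP => q _ /=; rewrite ge_min lexx orbT.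
have fc2 : itv_family c2 by exact: itv_family_map (@homo_maxr _ _) fc.
have c2uv : all [pred q : R * R | (p.1 <= q.1) && (q.2 <= p.2)] c2.
  rewrite all_map; apply: sub_all cv => q /= qv.
  by rewrite le_max lexx orbT/= ge_max qv.
have no q q' : q' \in c2 -> non_overlapping p q -> non_overlapping q q'.
  move=> /(allP c2uv)/= /andP[h1 h2] /orP[h|h]; apply/orP.
    by right; exact: le_trans h.
  by left; exact: le_trans h1.
have : \sum_(q <- s) (var_below q.2 - var_below q.1) +
    variation_on F (c2 ++ r) <= eps.
  apply: ih.
    rewrite !itv_family_cat fs fc2 fr/= allrel_catr sr andbT.
    apply/andP; split; apply/allrelP => q q' hq hq'.
      by rewrite non_overlapping_sym; exact: (no _ _ hq (pr _ hq')).
    exact: (no _ _ hq' (ps _ hq)).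
  apply: le_lt_trans lsr.
  have l2 : total_length c2 <= p.2 - p.1 by exact: (total_length_within erefl).
  by rewrite !total_length_cat [total_length (p :: s)]big_cons -/(total_length s); lra.
rewrite variation_on_cat; lra.
Qed.

End TotalVariation.
End Variation.

(** * Differentiation of absolutely continuous functions *)

Section MonotoneDensity.
Context {R : realType}.
Local Notation mu := (@lebesgue_measure R).
Variable G : R -> R.
Hypothesis ndG : {homo G : x y / x <= y}.
Hypothesis svG : forall eps : R, 0 < eps -> exists2 delta : R, 0 < delta &
  forall s, itv_family s -> total_length s < delta ->
    \sum_(p <- s) (G p.2 - G p.1) <= eps.

Let rcG : right_continuous G.
Proof.
move=> x; apply/cvgrPdist_le => eps /svG[delta d0 h].
near=> y.
have xy : x <= y by near: y; exact: nbhs_right_ge.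
have := h [:: (x, y)]; rewrite /itv_family/= xy /total_length !big_seq1/=.
rewrite distrC ger0_norm ?subr_ge0 ?ndG//; apply => //.
by rewrite ltrBlDl; near: y; apply: nbhs_right_lt; rewrite ltrDl.
Unshelve. all: by end_near. Qed.

Let cG : cumulative R R := HB.pack G (isCumulative.Build _ _ R G ndG rcG).
Let nu := lebesgue_stieltjes_measure cG.

Let nu_oc x y : x <= y -> nu `]x, y]%classic = (G y - G x)%:E.
Proof.
move=> xy; rewrite /nu /lebesgue_stieltjes_measure /measure_extension.
by rewrite measurable_mu_extE/= ?wlength_itv_bnd//; exact: is_ocitv.
Qed.

Lemma non_overlapping_oo (p q : R * R) : p.1 < p.2 -> q.1 < q.2 ->
  `]p.1, p.2[ `&` `]q.1, q.2[ = set0 -> non_overlapping p q.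
Proof.
move=> p12 q12 pq0; rewrite /non_overlapping/=.
apply/orP; apply: contrapT => /not_orP[/negP + /negP]; rewrite -!ltNge => h1 h2.
(* The midpoint of the overlap. *)
pose x := (Num.max p.1 q.1 + Num.min p.2 q.2) / 2.
suff : (`]p.1, p.2[ `&` `]q.1, q.2[) x by rewrite pq0.
rewrite /= !in_itv/= /x.
by case: (leP p.1 q.1) => ?; case: (leP p.2 q.2) => ?; split; apply/andP; split; lra.
Qed.

Variables (a b : R).

(** Finitely many components of [U] form a family of total length below [delta], so every partial
    sum of the series for the mass of [U] is at most [eps]. *)
Let nu_open_small (eps : R) : 0 < eps -> exists2 delta : R, 0 < delta &
  forall U : set R, open U -> U `<=` `]a, b[%classic -> (mu U < delta%:E)%E ->
    (nu U <= eps%:E)%E.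
Proof.
move=> /svG[delta d0 h]; exists delta => // U oU Uab muU.
pose I := open_disjoint_itv oU.
have oI q : open (I q) by exact: open_disjoint_itv_open.
have mI q : measurable (I q) by exact: open_measurable.
have tI : trivIset setT I by exact: open_disjoint_itv_trivIset.
have UI : U = \bigcup_q I q by exact: open_disjoint_itv_bigcup.
have IE q : I q !=set0 -> I q = `]inf (I q), sup (I q)[%classic.
  move=> I0; have IU : I q `<=` `]a, b[%classic.
    by apply: subset_trans Uab; rewrite UI; exact: bigcup_sup.
  have lb : has_lbound (I q).
    by exists a => x /IU/=; rewrite in_itv/= => /andP[/ltW].
  have ub : has_ubound (I q).
    by exists b => x /IU/=; rewrite in_itv/= => /andP[_ /ltW].
  have := interval_bounded_interior
    (@open_disjoint_itv_is_interval R U oU q) lb ub.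
  rewrite ((interior_id _).1 (oI q)) => {1}->.
  by apply/seteqP; split => x /=; rewrite in_itv.
have Ilt q : I q !=set0 -> inf (I q) < sup (I q).
  move=> I0; have [x] := I0; rewrite {1}(IE _ I0)/= in_itv/= => /andP[].
  exact: lt_trans.
have muI q : I q !=set0 -> mu (I q) = (sup (I q) - inf (I q))%:E.
  by move=> I0; rewrite {1}(IE _ I0) lebesgue_measure_itv/= lte_fin Ilt.
(* Only an inequality: [nu_oc] evaluates half-open intervals, while the component is open. *)
have nuI q : I q !=set0 -> (nu (I q) <= (G (sup (I q)) - G (inf (I q)))%:E)%E.
  move=> I0; rewrite -(nu_oc (ltW (Ilt q I0))).
  rewrite {1}(IE _ I0); apply: le_measure; rewrite ?inE.
  - exact: measurable_itv.
  - exact: measurable_itv.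
  - by apply: subset_itvl; rewrite bnd_simp.
have bigcupE (m : {measure set (measurableTypeR R) -> \bar R}) :
    m U = (\sum_(0 <= q <oo) m (I q))%E.
  rewrite {1}UI measure_bigcup; [|by move=> i _; exact: mI|exact: tI].
  by apply: eq_eseriesl => i; rewrite in_setT.
rewrite [nu U](bigcupE (lebesgue_stieltjes_measure cG)).
apply: lime_le.
  apply: is_cvg_nneseries => *.
  exact: (@measure_ge0 _ _ _ (lebesgue_stieltjes_measure cG)).
apply: nearW => n.
pose qs := [seq q <- iota 0 n | `[< I q !=set0 >]].
pose s := [seq (inf (I q), sup (I q)) | q <- qs].
have qsI q : q \in qs -> I q !=set0 by rewrite mem_filter => /andP[/asboolP].
have sumE (f : nat -> \bar R) : (forall q, ~ (I q !=set0) -> f q = 0%E) ->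
    (\sum_(0 <= q < n) f q = \sum_(q <- qs) f q)%E.
  move=> f0; rewrite /qs big_filter [RHS]big_mkcond/= /index_iota subn0.
  by apply: eq_bigr => q _; case: asboolP => // /f0.
have I0 q : ~ (I q !=set0) -> I q = set0.
  by move=> /set0P/negP; rewrite negbK => /eqP.
rewrite sumE; last by move=> q /I0 ->; rewrite measure0.
apply: (@le_trans _ _ (\sum_(p <- s) (G p.2 - G p.1))%:E).
  rewrite /s big_map -sumEFin big_seq [leRHS]big_seq.
  by apply: lee_sum => q qqs; exact: (nuI q (qsI q qqs)).
rewrite lee_fin; apply: h.
  apply/andP; split.
    apply/allP => p /mapP[q qqs ->]; exact: (ltW (Ilt q (qsI q qqs))).
  rewrite pairwise_map; have : uniq qs by rewrite filter_uniq// iota_uniq.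
  rewrite uniq_pairwise.
  apply: (@sub_in_pairwise _ (mem qs)); last exact/allP.
  move=> q r qqs rqs qr; have Iq := qsI q qqs; have Ir := qsI r rqs.
  apply: non_overlapping_oo; rewrite /= ?Ilt//.
  rewrite -!IE//; apply: contraTeq qr => /set0P[x [qx rx]].
  by rewrite /= negbK; apply/eqP; apply: (tI q r) => //; exists x.
rewrite -lte_fin; apply: le_lt_trans muU.
rewrite (bigcupE mu).
apply: le_trans (nneseries_lim_ge n _) => //.
rewrite sumE; last by move=> q /I0 ->; rewrite measure0.
rewrite /total_length /s big_map -sumEFin big_seq [leRHS]big_seq le_eqVlt.
by apply/orP; left; apply/eqP; apply: eq_bigr => q qqs; exact: (esym (muI q (qsI q qqs))).
Qed.

Let nuab : (nu `]a, b[%classic < +oo)%E.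
Proof.
have [ab|ba] := leP a b; last first.
  have -> : `]a, b[%classic = set0 :> set R.
    by apply/seteqP; split => x //=; rewrite in_itv/= => /andP[? ?]; lra.
  by rewrite [nu set0](measure0 (lebesgue_stieltjes_measure cG)).
apply: (@le_lt_trans _ _ (nu `]a, b]%classic)); last by rewrite nu_oc// ltry.
apply: le_measure; rewrite ?inE; [exact: measurable_itv|exact: measurable_itv|].
by apply: subset_itvl; rewrite bnd_simp.
Qed.

Let nur : {finite_measure set (measurableTypeR R) -> \bar R} :=
  @mfrestr _ (measurableTypeR R) R `]a, b[%classic
    (lebesgue_stieltjes_measure cG) (measurable_itv _) nuab.

(** Outer regularity encloses a null set in an open set of Lebesgue measure below [delta], whose
    [nu]-mass is then at most [eps]. *)
Let nur_dom : nur `<< mu.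
Proof.
apply/null_content_dominatesP => A mA A0.
have mab : measurable (`]a, b[%classic : set R) by exact: measurable_itv.
apply/eqP; rewrite -measure_le0; apply/lee_addgt0Pr => eps e0; rewrite add0e.
have [delta d0 small] := nu_open_small e0.
have B0 : mu (A `&` `]a, b[%classic) = 0%E.
  by apply: subset_measure0 A0 => //; exact: measurableI.
have [U [oU AU muU]] := @lebesgue_regularity_outer R (A `&` `]a, b[%classic) delta
  (measurableI _ _ mA mab) (eq_ind_r (fun z => z < +oo)%E (ltry 0) B0) d0.
have oab : open (`]a, b[%classic : set R) by exact: interval_open.
have oV : open (U `&` `]a, b[%classic) by exact: openI.
change (nu (A `&` `]a, b[%classic) <= eps%:E)%E.
apply: (@le_trans _ _ (nu (U `&` `]a, b[%classic))).
  apply: le_measure; rewrite ?inE.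
  - exact: measurableI.
  - by apply: open_measurable.
  - by move=> x [Ax xab]; split => //; apply: AU; split.
apply: small => //.
apply: (@le_lt_trans _ _ (mu U)).
  by apply: le_measure; rewrite ?inE; [exact: open_measurable|exact: open_measurable|exact: subIsetl].
set B := A `&` _ in B0 AU muU.
have mB : measurable B by exact: measurableI.
have -> : mu U = (mu (U `\` B) + mu (U `&` B))%E.
  by apply: measureDI => //; exact: open_measurable.
suff -> : mu (U `&` B) = 0%E by rewrite adde0.
apply: subset_measure0 B0 => //; first by apply: measurableI => //; exact: open_measurable.
Qed.

Lemma monotone_density : exists g : R -> R,
  mu.-integrable setT (EFin \o g) /\
  forall x y, a < x -> x <= y -> y < b -> G y - G x = \int[mu]_(t in `]x, y]) g t.
Proof.
have [g [g0 gfin ig nug]] := radon_nikodym_sigma_finite nur_dom.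
have gE : EFin \o (fine \o g) = g by apply/funext => t /=; rewrite fineK.
exists (fine \o g); rewrite gE; split => // x y ax xy yb.
rewrite /Rintegral (_ : (fun t => _) = g)//.
rewrite -nug; last exact: measurable_itv.
rewrite -[nur _]/(nu (`]x, y]%classic `&` `]a, b[%classic)) (_ : _ `&` _ = `]x, y]%classic) ?nu_oc//.
apply/seteqP; split => [t []//|t xty]; split => //.
move: xty; rewrite /= !in_itv/= => /andP[xt ty].
by rewrite (lt_trans ax xt) (le_lt_trans ty yb).
Qed.

End MonotoneDensity.

(** * Absolutely continuous functions as integrals of their derivatives *)

Section AbsolutelyContinuous.
Context {R : realType}.
Local Notation mu := (@lebesgue_measure R).
Implicit Types F f : R -> R.

(** Jordan decomposition: [Fc] is the difference of [V] and [W], both nondecreasing and absolutely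
    continuous, so each has a density. *)
Lemma abs_cont_density T F : 0 < T -> absolutely_continuous_on 0 T F ->
  exists f, mu.-integrable setT (EFin \o f) /\
    forall t, 0 <= t -> t <= T -> F t = F 0 + \int[mu]_(s in `]0, t]) f s.
Proof.
move=> T0 acF; pose Fc := F \o clamp T; pose V := var_below Fc.
have svF : small_variation Fc by exact: small_variation_clamp (ltW T0) acF.
have F0 x : x <= 0 -> Fc x = Fc 0.
  move=> x0; rewrite /Fc/= /clamp (min_idPl (ltW T0)) maxxx (max_idPl _)//.
  by rewrite ge_min x0.
have FT x : T <= x -> Fc x = Fc T.
  by move=> Tx; rewrite /Fc/= /clamp (min_idPr Tx) minxx.
have incr x y : x <= y -> `|Fc y - Fc x| <= V y - V x.
  exact: (var_below_incr svF F0 FT).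
have small := var_below_small svF F0 FT.
have ndV : {homo V : x y / x <= y}.
  move=> x y xy; rewrite -subr_ge0.
  exact: le_trans (normr_ge0 _) (incr _ _ xy).
pose W := V \- Fc.
have ndW : {homo W : x y / x <= y}.
  move=> x y /incr h; rewrite /W/= -subr_ge0.
  by have := ler_norm (Fc y - Fc x); lra.
have smallW (eps : R) : 0 < eps -> exists2 delta : R, 0 < delta &
    forall s, itv_family s -> total_length s < delta ->
      \sum_(p <- s) (W p.2 - W p.1) <= eps.
  (* Increments of [W] are at most twice those of [V]. *)
  move=> e0; have [delta d0 h] := small (eps / 2) ltac:(lra).
  exists delta => // s fs ls; have {}h := h s fs ls.
  apply: (@le_trans _ _ (\sum_(p <- s) (V p.2 - V p.1) * 2)); last first.
    by rewrite -mulr_suml -ler_pdivlMr.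
  rewrite big_seq [leRHS]big_seq; apply: ler_sum => p ps.
  move/andP: fs => [/allP/(_ _ ps)/= p12 _]; have := incr _ _ p12.
  by have := ler_norm (- (Fc p.2 - Fc p.1)); rewrite normrN /W/=; lra.
(* The window is larger than [0, T] because [monotone_density] wants both end points strictly
   inside. *)
have [g1 [ig1 g1E]] := monotone_density ndV small (-1) (T + 1).
have [g2 [ig2 g2E]] := monotone_density ndW smallW (-1) (T + 1).
exists (g1 \- g2); split.
  by have := integrableB measurableT ig1 ig2; apply: eq_integrable.
move=> t t0 tT; rewrite RintegralB//; last 2 first.
- exact: integrableS ig1.
- exact: integrableS ig2.
have m1 : -1 < 0 :> R by rewrite oppr_lt0.
have tT1 : t < T + 1 by lra.
rewrite -g1E// -g2E//.
have FcE x : 0 <= x -> x <= T -> Fc x = F x.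
  by move=> *; rewrite /Fc/= clamp_id.
by rewrite -(FcE _ t0 tT) -(FcE 0 (lexx 0) (ltW T0)) /W/=; ring.
Qed.

(** For a fractional integral [P] the value at 0 is a mere convention, so agreement with [F] is
    asked on []0, T]] and the constant is taken from [F 0]. The derivative comes from Lebesgue
    differentiation. *)
Lemma abs_cont_derive T F P : 0 < T -> absolutely_continuous_on 0 T F ->
  (forall t, 0 < t -> t <= T -> F t = P t) ->
  exists2 f, mu.-integrable setT (EFin \o f) &
    {ae mu, forall t, 0 < t -> t < T -> derive1 P t = f t} /\
    exists c, forall t, 0 < t -> t < T -> P t = c + \int[mu]_(s in `]0, t[) f s.
Proof.
move=> T0 acF FP; have [f [if_ fE]] := abs_cont_density T0 acF.
have ifS (D : set R) : measurable D -> mu.-integrable D (EFin \o f).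
  by move=> mD; exact: integrableS if_.
exists f => //; split; last first.
  exists (F 0) => t t0 tT; rewrite -FP ?ltW// fE ?ltW//.
  by rewrite Rintegral_itv_bndo_bndc//; exact: ifS.
have := @FTC1 R f (BRight 0) (fun y => ifS _ (measurable_itv _))
  (open_integrable_locally openT if_).
apply: (@filterS _ _ (ae_filter_ringOfSetsType mu)) => t /= h t0 tT.
have {h}[dI IE] := h t0.
rewrite -IE !derive1E.
pose I y := \int[mu]_(s in `]0, y]) f s.
rewrite -(@near_eq_derive _ _ _ (cst (F 0) \+ I)).
  by rewrite deriveD// derive_cst add0r.
have t0T : t \in `]0, T[ by rewrite in_itv/= t0.
have := near_in_itvoo t0T; apply: filterS => y; rewrite in_itv/= => /andP[y0 yT].
by rewrite /= -fE ?ltW// FP// ltW.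
Qed.

End AbsolutelyContinuous.

(** * Calculus of fractional integrals *)

Section FractionalCalculus.
Context {R : realType}.
Local Notation mu := (@lebesgue_measure R).
Implicit Types (u v : R -> R) (a b c s t T M : R).

(** The positive or the negative part has infinite integral, so the extended integral is infinite
    and [fine] sends it to 0. *)
Lemma Rintegral_notintegrable d (X : measurableType d)
    (m : {measure set X -> \bar R}) (D : set X) (f : X -> R) :
  measurable D -> measurable_fun D f -> ~ m.-integrable D (EFin \o f) ->
  \int[m]_(x in D) f x = 0.
Proof.
move=> mD mf nif; rewrite /Rintegral integralE.
have mfE : measurable_fun D (EFin \o f) by exact/measurable_EFinP.
have pos_ge0 : (0 <= \int[m]_(x in D) (EFin \o f)^\+ x)%E by apply: integral_ge0.
have neg_ge0 : (0 <= \int[m]_(x in D) (EFin \o f)^\- x)%E by apply: integral_ge0.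
have : ~ (\int[m]_(x in D) (EFin \o f)^\+ x < +oo /\
          \int[m]_(x in D) (EFin \o f)^\- x < +oo)%E.
  move=> [ip im]; apply: nif; apply/integrableP; split => //.
  under eq_integral do rewrite -/((abse \o (EFin \o f)) _) fune_abse.
  rewrite ge0_integralD//; [exact: lte_add_pinfty| |].
  - exact: measurable_funepos.
  - exact: measurable_funeneg.
move: pos_ge0 neg_ge0; rewrite /comp.
case: (integral _ _ _) => [x| |]; case: (integral _ _ _) => [y| |]//= _ _.
by move=> h; exfalso; apply: h; rewrite !ltry.
Qed.

(** Where [f] is not integrable both sides take the default value 0, so constants come out of a
    fractional integral at every time. *)
Lemma RintegralZl_measurable d (X : measurableType d)
    (m : {measure set X -> \bar R}) (D : set X) (f : X -> R) c :
  measurable D -> measurable_fun D f ->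
  \int[m]_(x in D) (c * f x) = c * \int[m]_(x in D) f x.
Proof.
move=> mD mf; have [->|c0] := eqVneq c 0.
  rewrite mul0r /Rintegral; under eq_integral do rewrite mul0r.
  by rewrite integral0.
have [if_|nif] := pselect (m.-integrable D (EFin \o f)).
  exact: RintegralZl.
rewrite !Rintegral_notintegrable ?mulr0//.
  by apply: measurable_funM.
move=> /(integrableZl mD c^-1) icf; apply: nif.
apply: eq_integrable icf => // x _.
by rewrite /= -EFinM mulrA mulVf// mul1r.
Qed.

Lemma measurable_frac_kernel a t (D : set R) :
  measurable_fun D (fun s => (t - s) `^ (a - 1)).
Proof.
apply: measurable_funTS; apply: (measurableT_comp (measurable_powR _)).
exact: measurable_funB.
Qed.

Lemma frac_intZ a c u t : measurable_fun `]0, t[ u ->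
  frac_int a (fun s => c * u s) t = c * frac_int a u t.
Proof.
move=> m_u; rewrite /frac_int -RintegralZl_measurable//.
  by apply: eq_Rintegral => s _; ring.
by apply: measurable_funM => //; exact: measurable_frac_kernel.
Qed.

Lemma frac_int_eq_ae a u v t :
  {ae mu, forall s, 0 < s -> s < t -> u s = v s} ->
  frac_int a u t = frac_int a v t.
Proof.
move=> uv; rewrite /frac_int /Rintegral; congr fine; apply: integral_eq_ae.
apply: (@filterS _ _ (ae_filter_ringOfSetsType mu)) uv => s uvs.
by rewrite /= in_itv/= => /andP[s0 st]; rewrite uvs.
Qed.

Lemma frac_int1 u t : frac_int 1 u t = \int[mu]_(s in `]0, t[) u s.
Proof. by apply: eq_Rintegral => s _; rewrite subrr powRr0 mul1r. Qed.

Lemma integrable_frac_int_bounded a u t M : 0 < a -> 0 < t ->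
  measurable_fun `]0, t[ u -> (forall s, 0 < s -> s < t -> `|u s| <= M) ->
  mu.-integrable `]0, t[ (fun s => ((t - s) `^ (a - 1) * u s)%:E).
Proof.
move=> a0 t0 m_u uM.
have M0 : 0 <= M by apply: le_trans (uM (t / 2) _ _) => //; lra.
(* [rkernel 1] is the indicator of the positive half-line, so the majorant is a multiple of a
   convolution of two kernels. *)
have it : mu.-integrable setT (fun s => (M * rkernel a (t - s) * rkernel 1 s)%:E).
  apply/integrableP; split.
    apply/measurable_EFinP/measurable_funM; last exact: measurable_rkernel.
    apply: measurable_funM => //.
    by apply: (measurableT_comp (measurable_rkernel _)); exact: measurable_funB.
  rewrite (_ : integral _ _ _ = \int[mu]_s (M%:E *
      (rkernel a (t - s) * rkernel 1 (s - 0))%R%:E))%E; last first.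
    apply: eq_integral => s _; rewrite subr0 abse_EFin ger0_norm.
      by rewrite -EFinM mulrA.
    by rewrite !mulr_ge0 ?rkernel_ge0.
  rewrite ge0_integralZl//.
  - by rewrite integral_rkernel_conv// -EFinM ltry.
  - apply/measurable_EFinP/measurable_funM.
      by apply: (measurableT_comp (measurable_rkernel _)); exact: measurable_funB.
    by apply: (measurableT_comp (measurable_rkernel _)); exact: measurable_funB.
  - by move=> s _; rewrite lee_fin mulr_ge0 ?rkernel_ge0.
have : mu.-integrable `]0, t[
    (fun s => (M * rkernel a (t - s) * rkernel 1 s)%:E) by exact: integrableS it.
apply: le_integrable => //.
  by apply/measurable_EFinP/measurable_funM => //; exact: measurable_frac_kernel.
move=> s; rewrite /= in_itv/= => /andP[s0 st].
rewrite lee_fin !normrM (ger0_norm (powR_ge0 _ _)).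
rewrite (ger0_norm M0) !(ger0_norm (rkernel_ge0 _ _)).
rewrite rkernel_gt0E ?subr_gt0// rkernel_gt0E// subrr powRr0 mulr1 mulrC.
by rewrite ler_wpM2r ?powR_ge0// uM.
Qed.

Lemma frac_int_cst1 a t : 0 < a -> 0 < t ->
  frac_int a (cst 1) t = Beta a 1 * t `^ a.
Proof.
move=> a0 t0; rewrite (frac_intE _ _ (lexx t)) /conv /Rintegral.
transitivity (fine (\int[mu]_x (rkernel a (t - x) * rkernel 1 (x - 0))%:E)%E).
  congr fine; apply: eq_integral => x _; rewrite subr0 patchE mem_setE in_itv/=.
  congr EFin; have [x0|x0] := ltP 0 x; last by rewrite (rkernel_le0E 1 x0) !mulr0.
  rewrite (rkernel_gt0E 1 x0) subrr powRr0.
  case: (ltP x t) => //= tx; rewrite (@rkernel_le0E _ a (t - x)) ?mul0r//.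
  by rewrite subr_le0.
rewrite integral_rkernel_conv//= subr0 rkernel_gt0E//.
by congr (_ * _ `^ _); ring.
Qed.

(** The primitive of [f] is bounded by the L^1 norm of [f], so both terms are integrable against the
    kernel at every [t] and the sum can be split. *)
Lemma frac_int_affine a c f t : 0 < a -> 0 < t ->
  mu.-integrable setT (EFin \o f) ->
  frac_int a (fun s => c + \int[mu]_(r in `]0, s[) f r) t =
  c * Beta a 1 * t `^ a + Beta a 1 * frac_int (a + 1) f t.
Proof.
move=> a0 t0 if_.
have it : mu.-integrable `]0, t[ (EFin \o f) by exact: integrableS if_.
have i1 := integrable_frac_int ltr01 t0 it.
have m1 : measurable_fun `]0, t[ (frac_int 1 f).
  by apply/measurable_EFinP; exact: measurable_int i1.
rewrite -(@frac_int_comp _ a 1 f t)//; last by rewrite lerDr ltW.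
rewrite -mulrA -(frac_int_cst1 a0 t0) -frac_intZ; last exact: measurable_cst.
rewrite /frac_int -RintegralD//.
- apply: eq_Rintegral => s _; rewrite -/(frac_int 1 f s) frac_int1 /=.
  by rewrite mulr1 mulrDr.
- exact: (@integrable_frac_int_bounded a (fun=> c * 1) t `|c * 1|).
- apply: (@integrable_frac_int_bounded a (frac_int 1 f) t
     (\int[mu]_x `|f x|)) => //.
  move=> s s0 st; rewrite frac_int1.
  apply: le_trans (le_normr_Rintegral _ _) _ => //.
    by exact: integrableS if_.
  have ia : mu.-integrable setT (fun x => `|f x|%:E).
    exact: (integrable_norm if_).
  apply: fine_le.
  - by apply: integrable_fin_num => //; exact: integrableS ia.
  - exact: integrable_fin_num.
  - by apply: ge0_subset_integral => //; exact: measurable_int ia.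
Qed.

Lemma ae_pos_bounded (Q : R -> Prop) :
  (forall T, 0 < T -> {ae mu, forall t, 0 < t -> t < T -> Q t}) ->
  {ae mu, forall t, 0 < t -> Q t}.
Proof.
move=> h; have : {ae mu, forall t, forall n : nat, 0 < t -> t < n.+1%:R -> Q t}.
  by apply/ae_foralln => n; exact: h.
apply: (@filterS _ _ (ae_filter_ringOfSetsType mu)) => t ht t0.
by apply: (ht (Num.truncn t)) => //; exact: truncnS_gt.
Qed.

Lemma Rintegral_eq0_ae (f : R -> R) :
  (forall T, 0 < T -> mu.-integrable `]0, T[ (EFin \o f)) ->
  (forall t, 0 < t -> \int[mu]_(s in `]0, t[) f s = 0) ->
  {ae mu, forall t, 0 < t -> f t = 0}.
Proof.
move=> if_ f0; apply: ae_pos_bounded => T T0.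
have ifT := integrable_restrict (measurable_itv _) (if_ T T0).
have ifS (D : set R) : measurable D -> mu.-integrable D (EFin \o (f \_ `]0, T[)).
  by move=> mD; exact: integrableS ifT.
have := @FTC1 R (f \_ `]0, T[) (BRight 0) (fun y => ifS _ (measurable_itv _))
  (open_integrable_locally openT ifT).
apply: (@filterS _ _ (ae_filter_ringOfSetsType mu)) => t /= h t0 tT.
have {h}[_] := h t0; rewrite patchE mem_setE in_itv/= t0 tT /= => <-.
rewrite derive1E -(@near_eq_derive _ _ _ (cst 0)) ?derive_cst//.
have t0T : t \in `]0, T[ by rewrite in_itv/= t0.
have := near_in_itvoo t0T; apply: filterS => y; rewrite in_itv/= => /andP[y0 yT].
rewrite /= -Rintegral_itv_bndo_bndc; last exact: ifS.
rewrite -[LHS](f0 y y0); apply: eq_Rintegral => s; rewrite inE/= in_itv/=.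
by move=> /andP[s0 sy]; rewrite patchE mem_setE in_itv/= s0 (lt_trans sy yT).
Qed.

End FractionalCalculus.

(** * Volterra form of the model *)

Section Volterra.
Context {R : realType}.
Local Notation mu := (@lebesgue_measure R).
Implicit Types (a b c s t T : R).

Lemma integral_expRN : (\int[mu]_(x in `[0%R, +oo[) (expR (- x))%:E = 1)%E.
Proof.
rewrite integral_mkcond -(@integral_exponential_pdf R 1)//.
apply: eq_integral => x _; rewrite patchE /exponential_pdf patchE.
by case: ifP => // _; rewrite mul1r mulN1r.
Qed.

(** Finiteness must be shown as well, since [fine] of an infinite integral is 0. The majorant is the
    kernel on ]0, 1[ plus the exponential. *)
Lemma Gamma_gt0 s : 0 < s -> s <= 1 -> 0 < Gamma s.
Proof.
move=> s0 s1; rewrite /Gamma /Rintegral.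
pose f x : R := x `^ (s - 1) * expR (- x).
have mf : measurable_fun setT (fun x : R => (f x)%:E).
  apply/measurable_EFinP/measurable_funM; first exact: measurable_powR.
  by apply: measurableT_comp.
have f0 x : (0 <= (f x)%:E)%E by rewrite lee_fin mulr_ge0 ?powR_ge0 ?expR_ge0.
apply: fine_gt0; apply/andP; split.
  apply: (@lt_le_trans _ _ (\int[mu]_(x in `[(1/2)%R, 1%R]) (expR (-1))%:E)%E).
    rewrite integral_cst//= lebesgue_measure_itv/= lte_fin ifT; last by lra.
    by rewrite -EFinB -EFinM lte_fin mulr_gt0 ?expR_gt0//; lra.
  apply: (@le_trans _ _ (\int[mu]_(x in `[(1/2)%R, 1%R]) (f x)%:E)%E).
    apply: ge0_le_integral => //.
    - exact: measurable_funTS.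
    - move=> x; rewrite /= in_itv/= => /andP[x2 x1]; rewrite lee_fin /f.
      rewrite -[leLHS]mul1r ler_pM ?expR_ge0//; last by rewrite ler_expR lerN2.
      have x0 : 0 < x <= 1 by lra.
      rewrite -[leLHS](powRr0 x); apply: ger_powR => //; lra.
  apply: ge0_subset_integral => //; first exact: measurable_funTS.
  by move=> x /=; rewrite !in_itv/= andbT => /andP[x2 _]; lra.
apply: (@le_lt_trans _ _ (\int[mu]_x (trunc_rkernel 1 s x)%:E +
   \int[mu]_(x in `[0%R, +oo[) (expR (- x))%:E)%E); last first.
  by rewrite integral_trunc_rkernel// integral_expRN ltry.
rewrite [X in (_ <= _ + X)%E]integral_mkcond -ge0_integralD//; first last.
- apply/(measurable_restrictT _ _).1 => //; apply: measurable_funTS.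
  by apply/measurable_EFinP; apply: measurableT_comp.
- by move=> x _; rewrite patchE; case: ifP => // _; rewrite lee_fin expR_ge0.
- by apply/measurable_EFinP; exact: measurable_trunc_rkernel.
- by move=> x _; rewrite lee_fin trunc_rkernel_ge0.
rewrite integral_mkcond; apply: ge0_le_integral => //.
- by move=> x _; rewrite patchE; case: ifP => // _; exact: (f0 x).
- by apply/(measurable_restrictT _ _).1 => //; apply: measurable_funTS; exact: mf.
- apply: emeasurable_funD.
    by apply/measurable_EFinP; exact: measurable_trunc_rkernel.
  apply/(measurable_restrictT _ _).1 => //; apply: measurable_funTS.
  by apply/measurable_EFinP; apply: measurableT_comp.
move=> x _; rewrite !patchE !mem_setE !in_itv/= !andbT.
have [x0|x0] := ltP 0 x; last first.
  by case: ifP => _; rewrite adde_ge0// lee_fin ?trunc_rkernel_ge0 ?expR_ge0.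
rewrite (ltW x0) -EFinD lee_fin /trunc_rkernel rkernel_gt0E//.
have ex1 : expR (- x) <= 1 by rewrite expR_le1 oppr_le0 ltW.
have := expR_ge0 (- x); have := powR_ge0 x (s - 1).
have [x1|x1] := ltP x 1 => p0 e0 /=.
  by rewrite -[leLHS]addr0 lerD// ler_piMr.
rewrite add0r ler_piMl// -[leRHS](powRr0 x).
by apply: ler_powR => //; lra.
Qed.

Lemma RL_integralE a (g : R -> R) : 0 < a ->
  RL_integral a g = fun t => (Gamma a)^-1 * frac_int a g t.
Proof. by move=> a0; rewrite /RL_integral gt_eqF. Qed.

Lemma RL_integral0 (g : R -> R) : RL_integral 0 g = g.
Proof. by rewrite /RL_integral eqxx. Qed.

Lemma measurable_frac_int a t u : 0 < a -> 0 < t ->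
  mu.-integrable `]0, t[ (EFin \o u) -> measurable_fun `]0, t[ (frac_int a u).
Proof.
move=> a0 t0 iu; apply/measurable_EFinP.
exact: measurable_int (integrable_frac_int a0 t0 iu).
Qed.

(* Composing with the complementary fractional integral turns [I^a] into the
   ordinary integral. *)
Lemma frac_int_RL_integral a p : 0 <= a -> a < 1 ->
  (forall T, 0 < T -> mu.-integrable `]0, T[ (EFin \o p)) ->
  exists2 k, 0 < k & forall t, 0 < t ->
    \int[mu]_(s in `]0, t[) p s = k * frac_int (1 - a) (RL_integral a p) t.
Proof.
rewrite le_eqVlt => /predU1P[<- _ _|a0 a1 ip].
  by exists 1 => // t t0; rewrite mul1r subr0 RL_integral0 frac_int1.
have a'0 : 0 < 1 - a by rewrite subr_gt0.
have B0 := Beta_gt0 a'0 a0; have G0 := Gamma_gt0 a0 (ltW a1).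
exists (Gamma a / Beta (1 - a) a) => [|t t0]; first by rewrite divr_gt0.
rewrite RL_integralE// frac_intZ; last exact: measurable_frac_int (ip t t0).
rewrite frac_int_comp ?subrK//; last exact: ip.
by rewrite frac_int1; field; rewrite !gt_eqF.
Qed.

(** Order 1 + a splits as (1 + m) + b, and the inner integral of order [b] is the Hilfer derivative,
    known from the model to be [w]. [fT] is a measurable version of the derivative [f]. For [b = 0]
    the operator is the identity, hence the case distinction in the factor. *)
Lemma frac_int_density a b m f fT w t : 0 <= b -> 0 < m -> 0 < t ->
  b <= 1 -> m + b = a ->
  mu.-integrable setT (EFin \o fT) ->
  {ae mu, forall s, 0 < s -> s < t -> f s = fT s} ->
  {ae mu, forall s, 0 < s -> s < t -> RL_integral b f s = w s} ->
  mu.-integrable `]0, t[ (EFin \o w) ->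
  frac_int (1 + a) fT t =
  (if b == 0 then 1 else Gamma b / Beta (1 + m) b) * frac_int (1 + m) w t.
Proof.
move=> b0 mu0 t0 b1 <- ifT ffT bfw iw.
have iftT : mu.-integrable `]0, t[ (EFin \o fT) by exact: integrableS ifT.
have [b_eq0|b_neq0] := eqVneq b 0.
  rewrite b_eq0 addr0 mul1r; apply: frac_int_eq_ae.
  move: bfw; rewrite b_eq0 RL_integral0 => fw.
  apply: (@filterS2 _ _ (ae_filter_ringOfSetsType mu)) ffT fw => s h1 h2 s0 st.
  by rewrite -h1// h2.
have {}b0 : 0 < b by rewrite lt_neqAle eq_sym b_neq0.
have mu1 : 0 < 1 + m by rewrite addr_gt0.
have G0 := Gamma_gt0 b0 b1; have B0 := Beta_gt0 mu1 b0.
have fw : frac_int (1 + m) w t =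
    frac_int (1 + m) (fun s => (Gamma b)^-1 * frac_int b fT s) t.
  apply: frac_int_eq_ae; apply: (@filterS _ _ (ae_filter_ringOfSetsType mu)) bfw.
  move=> s h s0 st; rewrite -h// RL_integralE//; congr (_ * _).
  apply: frac_int_eq_ae; apply: (@filterS _ _ (ae_filter_ringOfSetsType mu)) ffT.
  by move=> r hr r0 rs; rewrite hr// (lt_trans rs).
rewrite fw frac_intZ; last exact: measurable_frac_int.
rewrite frac_int_comp//; last by rewrite -addrA lerDl addr_ge0 ?ltW.
by rewrite addrA; field; rewrite !gt_eqF.
Qed.

Lemma integral_powRN a t : a < 1 -> 0 < t ->
  \int[mu]_(s in `]0, t[) s `^ (- a) = t `^ (1 - a) / (1 - a).
Proof.
move=> a1 t0; rewrite -[RHS]/(fine _%:E) -integral_powR ?subr_gt0 ?ltW//.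
by congr fine; apply: eq_integral => s _; rewrite addrAC subrr sub0r.
Qed.

Lemma integrable_powRN a t : a < 1 -> 0 < t ->
  mu.-integrable `]0, t[ (EFin \o (fun s => s `^ (- a))).
Proof.
move=> a1 t0; apply/integrableP; split.
  by apply/measurable_EFinP; apply: measurable_funTS; exact: measurable_powR.
rewrite (_ : integral _ _ _ =
    \int[mu]_(s in `]0%R, t[) (s `^ ((1 - a) - 1))%R%:E)%E.
  by rewrite integral_powR ?subr_gt0 ?ltW// ltry.
apply: eq_integral => s _; rewrite /= ger0_norm ?powR_ge0//.
by rewrite addrAC subrr sub0r.
Qed.

End Volterra.

Section IntegrableReal.
Context {R : realType}.
Local Notation mu := (@lebesgue_measure R).
Variables (i : interval R) (f g : R -> R).
Hypotheses (if_ : mu.-integrable [set` i] (EFin \o f))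
  (ig : mu.-integrable [set` i] (EFin \o g)).

Lemma integrable_real_add : mu.-integrable [set` i] (EFin \o (fun x => f x + g x)).
Proof.
have := integrableD (measurable_itv i : measurable ([set` i] : set (measurableTypeR R))) if_ ig.
exact: eq_integrable.
Qed.

Lemma integrable_real_sub : mu.-integrable [set` i] (EFin \o (fun x => f x - g x)).
Proof.
have := integrableB (measurable_itv i : measurable ([set` i] : set (measurableTypeR R))) if_ ig.
exact: eq_integrable.
Qed.

Lemma integrable_itv_cst (a b c : R) : mu.-integrable `]a, b[ (EFin \o (fun=> c)).
Proof.
apply/integrableP; split; first exact: measurable_cst.
rewrite (integral_cst _ _ `|c|%:E)//= lebesgue_measure_itv/= lte_fin.
by case: ifP => _; rewrite ?mule0 ?ltry// -EFinB -EFinM ltry.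
Qed.

Lemma integrable_real_scale c : mu.-integrable [set` i] (EFin \o (fun x => c * f x)).
Proof.
have := integrableZl (measurable_itv i : measurable ([set` i] : set (measurableTypeR R))) c if_.
exact: eq_integrable.
Qed.

End IntegrableReal.

(** * From the cobweb model to the Volterra equation *)

Section CobwebVolterra.
Context {R : realType}.
Local Notation leb := (@lebesgue_measure R).

(** Order 1 - a applied to [P] gives the primitive of the price, so the equation first appears
    integrated once, with all orders large enough for the pointwise semigroup law, and is then
    differentiated almost everywhere. *)
Lemma cobweb_volterra (alpha beta alpha1 beta1 mu nu : R) (p : R -> R)
    (a := (1 - nu) * (1 - mu)) (pe := (alpha1 - alpha) / (beta - beta1)) :
  beta != 0 -> beta != beta1 -> 0 < mu -> mu <= 1 -> 0 <= nu -> nu <= 1 ->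
  beta1 / beta < 1 -> cobweb_solution alpha beta alpha1 beta1 mu nu p ->
  exists C k, 0 < k /\ {ae leb, forall t, 0 < t ->
    p t - pe = C * t `^ (- a) - pe - k * frac_int mu (fun s => p s - pe) t}.
Proof.
move=> b0 bb1 mu0 mu1 nu0 nu1 stab [cp ip acp eqp].
pose b := nu * (1 - mu); pose lam := 1 - beta1 / beta.
(* The stability condition enters here: it makes the constant of the Volterra equation positive. *)
have lam0 : 0 < lam by rewrite subr_gt0.
have a0 : 0 <= a by rewrite mulr_ge0 ?subr_ge0.
have b_ge0 : 0 <= b by rewrite mulr_ge0 ?subr_ge0.
have ab : a + b = 1 - mu by rewrite /a /b; ring.
have a1 : a < 1 by lra.
have b1 : b <= 1 by lra.
pose q s := p s - pe; pose w s := - lam * q s.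
pose P := RL_integral a p; pose f := derive1 P.
have iq T : 0 < T -> leb.-integrable `]0, T[ (EFin \o q).
  by move=> T0; exact: integrable_real_sub (ip T T0) (integrable_itv_cst 0 T pe).
have iw T : 0 < T -> leb.-integrable `]0, T[ (EFin \o w).
  by move=> T0; exact: integrable_real_scale (iq T T0) (- lam).
have eqw : {ae leb, forall s, 0 < s -> RL_integral b f s = w s}.
  apply: (@filterS _ _ (ae_filter_ringOfSetsType leb)) eqp => s + s0.
  move=> /(_ s0); rewrite /demand /supply /Hilfer_derivative -/a -/b -/P -/f => h.
  have bb1' : beta - beta1 != 0 by rewrite subr_eq0.
  have -> : RL_integral b f s =
      (alpha1 + beta1 * p s - alpha) / beta - p s by rewrite -h; field.
  by rewrite /w /q /pe /lam; field; rewrite ?b0 ?bb1'.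
have [k1 k1_gt0 pE] := frac_int_RL_integral a0 a1 ip.
pose k2 := if b == 0 then 1 else Gamma b / Beta (1 + mu) b.
have k2_gt0 : 0 < k2.
  rewrite /k2; case: eqVneq => // b_neq0.
  have {}b_gt0 : 0 < b by rewrite lt_neqAle eq_sym b_neq0.
  by rewrite divr_gt0 ?Gamma_gt0 ?Beta_gt0// addr_gt0.
(* Each horizon [T] brings its own density and constant; expressing the constant through time 1
   makes it independent of [T]. *)
pose c0 := P 1 - \int[leb]_(s in `]0, 1[) f s.
have a'0 : 0 < 1 - a by rewrite subr_gt0.
pose B1 := Beta (1 - a) 1; have B1_gt0 : 0 < B1 by exact: Beta_gt0.
pose B2 := Beta 1 mu; have B2_gt0 : 0 < B2 by exact: Beta_gt0.
have pE2 t : 0 < t -> \int[leb]_(s in `]0, t[) p s =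
    k1 * c0 * B1 * t `^ (1 - a) + k1 * B1 * k2 * frac_int (1 + mu) w t.
  (* This horizon exceeds both [t] and the reference time 1. *)
  move=> t0; rewrite pE// -/P; pose T := t + 1.
  have T0 : 0 < T by rewrite addr_gt0.
  have [F [FP acF]] := acp T T0.
  have [fT ifT [dP [c Pc]]] := @abs_cont_derive R T F P T0 acF FP.
  have tT : t < T by rewrite ltrDl.
  have oneT : 1 < T by rewrite ltrDr.
  have cE : c = c0.
    rewrite /c0 Pc//; have -> : \int[leb]_(s in `]0, 1[) f s =
        \int[leb]_(s in `]0, 1[) fT s; last by rewrite addrK.
    rewrite -!frac_int1; apply: frac_int_eq_ae.
    apply: (@filterS _ _ (ae_filter_ringOfSetsType leb)) dP => s h s0 s1.
    exact: (h s0 (lt_trans s1 oneT)).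
  have -> : frac_int (1 - a) P t =
      frac_int (1 - a) (fun s => c0 + \int[leb]_(r in `]0, s[) fT r) t.
    apply: eq_Rintegral => s; rewrite inE/= in_itv/= => /andP[s0 st].
    by rewrite Pc ?cE// (lt_trans st).
  rewrite (frac_int_affine _ a'0 t0 ifT) -/B1.
  rewrite [1 - a + 1]addrC (@frac_int_density _ (1 - a) b mu f fT w t)//.
  - by rewrite -/k2; ring.
  - by lra.
  - apply: (@filterS _ _ (ae_filter_ringOfSetsType leb)) dP => s h s0 st.
    exact: (h s0 (lt_trans st tT)).
  - by apply: (@filterS _ _ (ae_filter_ringOfSetsType leb)) eqw => s h s0 _; rewrite h.
  - exact: iw.
(* [C] comes from differentiating the power t^(1 - a), and [k3] from writing order 1 + mu as order 1
   after order [mu]. *)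
pose C := k1 * c0 * B1 * (1 - a); pose k3 := k1 * B1 * k2 / B2.
have k3_gt0 : 0 < k3 by rewrite divr_gt0 ?mulr_gt0.
have ifq T : 0 < T -> leb.-integrable `]0, T[ (EFin \o frac_int mu w).
  by move=> T0; exact: integrable_frac_int (iw T T0).
have ipw T : 0 < T -> leb.-integrable `]0, T[
    (EFin \o (fun s => C * s `^ (- a) + k3 * frac_int mu w s)).
  move=> T0; apply: integrable_real_add; apply: integrable_real_scale.
    exact: integrable_powRN.
  exact: ifq.
(* Both sides have the same primitive. *)
have ae0 : {ae leb, forall t, 0 < t ->
    p t - (C * t `^ (- a) + k3 * frac_int mu w t) = 0}.
  apply: Rintegral_eq0_ae => [T T0|t t0].
    exact: integrable_real_sub (ip T T0) (ipw T T0).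
  rewrite RintegralB//; [|exact: ip|exact: ipw].
  rewrite RintegralD//; last 2 first.
  - by apply: integrable_real_scale => //; exact: integrable_powRN.
  - by apply: integrable_real_scale => //; exact: ifq.
  rewrite RintegralZl//; last exact: integrable_powRN.
  rewrite RintegralZl//; last exact: ifq.
  rewrite integral_powRN// pE2// -[X in k3 * X]frac_int1.
  rewrite frac_int_comp//; [|by rewrite lerDl ltW|exact: iw].
  by rewrite -/B2 /C /k3; field; rewrite !gt_eqF.
exists C, (k3 * lam); split; first exact: mulr_gt0.
apply: (@filterS _ _ (ae_filter_ringOfSetsType leb)) ae0 => t ht t0.
have /eqP := ht t0; rewrite subr_eq0 => /eqP ->.
have -> : frac_int mu w t = - lam * frac_int mu q t.
  apply: frac_intZ; apply/measurable_EFinP; exact: measurable_int (iq t t0).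
by rewrite -/q; ring.
Qed.

End CobwebVolterra.

(** * Comparison principle *)

Section Comparison.
Context {R : realType}.
Local Notation leb := (@lebesgue_measure R).
Local Notation aeF := (ae_filter_ringOfSetsType leb).
Implicit Types (s t T r : R) (u : R -> R).

Lemma ae_neq t : {ae leb, forall s, s != t}.
Proof.
exists [set t]; split => //; first exact: lebesgue_measure_set1.
by move=> s /= /negP; rewrite negbK => /eqP.
Qed.

Lemma ae_exists_itv (Q : R -> Prop) s t : s < t -> {ae leb, forall x, Q x} ->
  exists2 x, s < x < t & Q x.
Proof.
move=> st [N [mN N0 QN]]; apply: contrapT => nQ.
have sub : `]s, t[%classic `<=` N.
  move=> x /= xst; apply: QN => /= Qx; apply: nQ; exists x => //.
have : leb `]s, t[%classic = 0%E.
  by apply: (subset_measure0 _ mN sub N0); exact: measurable_itv.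
rewrite lebesgue_measure_itv/= lte_fin st -EFinB => -[] /eqP.
by rewrite subr_eq0 gt_eqF.
Qed.

Variables (mu kap : R) (z g : R -> R).
Hypotheses (mu0 : 0 < mu) (mu1 : mu <= 1) (kap0 : 0 < kap).
Hypothesis iz : forall T, 0 < T -> leb.-integrable `]0, T[ (EFin \o z).
Hypothesis zE : {ae leb, forall t, 0 < t -> z t = g t - kap * frac_int mu z t}.
Hypothesis g_ge0 : forall t, 0 < t -> 0 <= g t.
Hypothesis g_mono : forall s t, 0 < s -> s <= t ->
  g s * s `^ (1 - mu) <= g t * t `^ (1 - mu).

Let k := rkernel mu.
(** Where [z] is already known to be nonnegative this changes it on a null set only, and it makes
    the history nonnegative at every point. *)
Let zp t := Num.max (z t) 0.
Let past t0 := zp \_ `]0, t0[.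
(** The forcing term of the equation restarted at [t0]: the contribution of the history is
    subtracted from [g]. *)
Let gt t0 t := g t - kap * conv k (past t0) t.

Let izp T : 0 < T -> leb.-integrable `]0, T[ (EFin \o zp).
Proof.
move=> T0; have := iz T0; apply: le_integrable => //.
  apply/measurable_EFinP/measurable_maxr => //.
  by apply/measurable_EFinP; exact: measurable_int (iz T0).
move=> t _; rewrite /= lee_fin /zp; case: (leP (z t) 0) => // _.
by rewrite normr0.
Qed.

Let past_ge0 t0 t : 0 <= past t0 t.
Proof. by rewrite /past patchE; case: ifP => // _; rewrite /zp le_max lexx orbT. Qed.

Let ipast t0 : 0 <= t0 -> leb.-integrable setT (EFin \o past t0).
Proof.
rewrite le_eqVlt => /predU1P[<-|t00].
  rewrite (_ : _ \o _ = cst 0%E); first exact: integrable0.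
  by apply/funext => t; rewrite /= /past set_itvoo0 patch_set0.
by apply: integrable_restrict; [exact: measurable_itv|exact: izp].
Qed.

Let measurable_kt t : measurable_fun [set: R] (fun s => k (t - s)).
Proof.
by apply: (measurableT_comp (measurable_rkernel _)); exact: measurable_funB.
Qed.

(** Seen from [t > t0] the kernel is bounded on the history, by (t - t0)^(mu - 1); at [t = t0] this
    bound is lost. *)
Let ipast_kernel t0 t : 0 <= t0 -> t0 < t ->
  leb.-integrable setT (fun s => (k (t - s) * past t0 s)%:E).
Proof.
move=> t00 t0t; have := integrableZl measurableT ((t - t0) `^ (mu - 1)) (ipast t00).
apply: le_integrable => //.
  apply/measurable_EFinP/measurable_funM; first exact: measurable_kt.
  by apply/measurable_EFinP; exact: measurable_int (ipast t00).
move=> s _; rewrite lee_fin !normrM (ger0_norm (rkernel_ge0 _ _)).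
rewrite (ger0_norm (powR_ge0 _ _)) /past patchE mem_setE in_itv/=.
case: ifPn => [/andP[s0 st0]|_]; last by rewrite normr0 !mulr0.
rewrite ler_wpM2r// rkernel_gt0E ?subr_gt0 ?(lt_trans st0)//.
rewrite -!(opprB 1 mu) !powRN lef_pV2 ?posrE ?powR_gt0 ?subr_gt0 ?(lt_trans st0)//.
apply: ge0_ler_powR; rewrite ?nnegrE ?subr_ge0//.
- exact: ltW.
- exact: ltW (lt_trans st0 t0t).
- by rewrite lerD2l lerN2 ltW.
Qed.

(** The quotient t / (t - r) decreases in [t]. This is the form in which log-convexity of the kernel
    is used. *)
Lemma rkernel_ratio r s t : 0 <= r -> r < s -> s <= t ->
  k (t - r) * t `^ (1 - mu) <= k (s - r) * s `^ (1 - mu).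
Proof.
move=> r0 rs st.
have s0 : 0 < s by exact: le_lt_trans rs.
have t0 : 0 < t by exact: lt_le_trans st.
have sr : 0 < s - r by rewrite subr_gt0.
have tr : 0 < t - r by rewrite subr_gt0 (lt_le_trans rs).
rewrite /k !rkernel_gt0E// -!(opprB 1 mu) !powRN.
rewrite [leLHS]mulrC ler_pdivrMr ?powR_gt0// -mulrA ler_pdivlMl ?powR_gt0//.
rewrite -!powRM ?(ltW s0) ?(ltW t0) ?(ltW sr) ?(ltW tr)//.
apply: ge0_ler_powR; rewrite ?nnegrE ?mulr_ge0 ?subr_ge0//.
all: nra.
Qed.

(** Integrability at both times is a hypothesis, so that [s = t0] is allowed; the restart needs this
    case. *)
Let conv_past_mono t0 s t : 0 <= t0 -> t0 <= s -> s <= t ->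
  leb.-integrable setT (fun r => (k (s - r) * past t0 r)%:E) ->
  leb.-integrable setT (fun r => (k (t - r) * past t0 r)%:E) ->
  conv k (past t0) t * t `^ (1 - mu) <= conv k (past t0) s * s `^ (1 - mu).
Proof.
move=> t00 t0s st is_ it; rewrite [leLHS]mulrC [leRHS]mulrC.
rewrite /conv -(RintegralZl _ measurableT it) -(RintegralZl _ measurableT is_).
apply: le_Rintegral => //.
- have := integrableZl measurableT (t `^ (1 - mu)) it; exact: eq_integrable.
- have := integrableZl measurableT (s `^ (1 - mu)) is_; exact: eq_integrable.
move=> r _; rewrite !mulrA /past patchE mem_setE in_itv/=.
case: ifPn => [/andP[r0 rt0]|_]; last by rewrite !mulr0.
rewrite ler_wpM2r ?le_max ?lexx ?orbT// ![_ `^ _ * _]mulrC.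
by apply: rkernel_ratio => //; [exact: ltW|exact: lt_le_trans t0s].
Qed.

Let gt_mono t0 s t : 0 <= t0 -> t0 < s -> s <= t ->
  gt t0 s * s `^ (1 - mu) <= gt t0 t * t `^ (1 - mu).
Proof.
move=> t00 t0s st; rewrite /gt [leLHS]mulrBl [leRHS]mulrBl lerB//.
  by apply: g_mono => //; exact: le_lt_trans t0s.
rewrite -[leLHS]mulrA -[leRHS]mulrA (ler_wpM2l (ltW kap0))//; apply: conv_past_mono => //; first exact: ltW.
  exact: ipast_kernel.
by apply: ipast_kernel => //; exact: lt_le_trans st.
Qed.

Let measurable_convE_kernel (u : R -> \bar R) :
  measurable_fun setT u -> (forall x, 0 <= u x)%E -> measurable_fun setT (convE k u).
Proof.
move=> m_u u0; apply: measurable_convE => //; first exact: measurable_rkernel.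
exact: rkernel_ge0.
Qed.

Let convE_kernel_ge0 (u : R -> \bar R) t : (forall x, 0 <= u x)%E -> (0 <= convE k u t)%E.
Proof. by move=> u0; apply: convE_ge0 => //; exact: rkernel_ge0. Qed.

Let le_convE_kernel (u v : R -> \bar R) t :
  measurable_fun setT u -> measurable_fun setT v ->
  (forall x, 0 <= u x)%E -> (forall x, 0 <= v x)%E ->
  {ae leb, forall s, s < t -> (u s <= v s)%E} -> (convE k u t <= convE k v t)%E.
Proof.
move=> m_u mv u0 v0 uv; apply: ae_ge0_le_integral => //.
- by move=> s _; rewrite mule_ge0// lee_fin rkernel_ge0.
- by apply: emeasurable_funM => //; apply/measurable_EFinP; exact: measurable_kt.
- by move=> s _; rewrite mule_ge0// lee_fin rkernel_ge0.
- by apply: emeasurable_funM => //; apply/measurable_EFinP; exact: measurable_kt.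
apply: (@filterS _ _ aeF) uv => s uvs _.
have [ts|st] := leP t s; first by rewrite /k rkernel_le0E ?subr_le0// !mul0e.
by rewrite lee_wpmul2l ?lee_fin ?rkernel_ge0// uvs.
Qed.

Let convE_kernelD (u v : R -> \bar R) t :
  measurable_fun setT u -> measurable_fun setT v ->
  (forall x, 0 <= u x)%E -> (forall x, 0 <= v x)%E ->
  (convE k (u \+ v) t = convE k u t + convE k v t)%E.
Proof.
move=> m_u mv u0 v0; rewrite /convE -ge0_integralD//.
- by apply: eq_integral => s _; rewrite ge0_muleDr.
- by move=> s _; rewrite mule_ge0// lee_fin rkernel_ge0.
- by apply: emeasurable_funM => //; apply/measurable_EFinP; exact: measurable_kt.
- by move=> s _; rewrite mule_ge0// lee_fin rkernel_ge0.
- by apply: emeasurable_funM => //; apply/measurable_EFinP; exact: measurable_kt.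
Qed.

Let convE_kernelZ c (u : R -> \bar R) t : 0 <= c ->
  measurable_fun setT u -> (forall x, 0 <= u x)%E ->
  (convE k (fun s => c%:E * u s) t = c%:E * convE k u t)%E.
Proof.
move=> c0 m_u u0; rewrite /convE -ge0_integralZl//.
- by apply: eq_integral => s _; rewrite muleCA.
- by apply: emeasurable_funM => //; apply/measurable_EFinP; exact: measurable_kt.
- by move=> s _; rewrite mule_ge0// lee_fin rkernel_ge0.
Qed.

(** [dBeta] controls one iteration of the equation on a window of length [delta]; [dnorm] bounds
    [kap] times the mass of the kernel truncated at [delta]. *)
Variable delta : R.
Hypotheses (d0 : 0 < delta) (dBeta : kap * (Beta mu mu * delta `^ mu) <= 1)
  (dnorm : kap * (delta `^ mu / mu) <= 1 / 2).

Section Step.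
Variable t0 : R.
Hypotheses (t00 : 0 <= t0)
  (past_pos : {ae leb, forall t, 0 < t -> t < t0 -> 0 <= z t})
  (gt_pos : forall t, t0 < t -> 0 <= gt t0 t).

Let T1 := t0 + delta.
Let z0 := z \_ `]t0, T1[.
(** The step amounts to showing that this negative part of [z] on the window vanishes almost
    everywhere. *)
Let n x := Num.max (- z0 x) 0.
Let P x := Num.max (z0 x) 0.

Let T1_gt0 : 0 < T1. Proof. exact: ltr_wpDl. Qed.

Let iz0 : leb.-integrable setT (EFin \o z0).
Proof.
apply: integrable_restrict; first exact: measurable_itv.
apply: integrableS (iz T1_gt0) => //; try exact: measurable_itv.
by apply: subset_itvr; rewrite bnd_simp.
Qed.

Let mz0 : measurable_fun setT z0.
Proof. by apply/measurable_EFinP; exact: measurable_int iz0. Qed.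

Let mn : measurable_fun setT n.
Proof. by apply: measurable_maxr => //; exact: measurableT_comp. Qed.

Let mP : measurable_fun setT P.
Proof. by apply: measurable_maxr. Qed.

Let n_ge0 x : 0 <= n x. Proof. by rewrite /n le_max lexx orbT. Qed.
Let P_ge0 x : 0 <= P x. Proof. by rewrite /P le_max lexx orbT. Qed.

Let in_ : leb.-integrable setT (EFin \o n).
Proof.
apply: le_integrable iz0 => //; first exact/measurable_EFinP.
move=> t _; rewrite /= lee_fin /n; case: (leP (- z0 t) 0) => _.
  by rewrite normr0.
by rewrite normrN.
Qed.

Let iP : leb.-integrable setT (EFin \o P).
Proof.
apply: le_integrable iz0 => //; first exact/measurable_EFinP.
move=> t _; rewrite /= lee_fin /P; case: (leP (z0 t) 0) => // _.
by rewrite normr0.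
Qed.

Let z0_out x : x <= t0 \/ T1 <= x -> z0 x = 0.
Proof.
rewrite /z0 patchE mem_setE in_itv/= => -[xt|xT].
  by rewrite ltNge xt.
by rewrite [x < T1]ltNge xT andbF.
Qed.

Let n_out x : x <= t0 \/ T1 <= x -> n x = 0.
Proof. by move=> /z0_out zx; rewrite /n zx oppr0 maxxx. Qed.

Let P_out x : x <= t0 \/ T1 <= x -> P x = 0.
Proof. by move=> /z0_out zx; rewrite /P zx maxxx. Qed.

Let z0_in x : t0 < x -> x < T1 -> z0 x = z x.
Proof. by move=> tx xT; rewrite /z0 patchE mem_setE in_itv/= tx xT. Qed.

Let z_decomp : {ae leb, forall s, (z \_ `]0, T1[) s = past t0 s + P s - n s}.
Proof.
apply: (@filterS2 _ _ aeF) past_pos (ae_neq t0) => s zs st0.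
rewrite patchE mem_setE in_itv/= /past patchE mem_setE in_itv/=.
have [s0|s0] := leP s 0.
  rewrite P_out ?n_out; try by left; exact: le_trans t00.
  by rewrite /= subr0 addr0.
have [sT|sT] := leP T1 s => /=.
  rewrite P_out ?n_out; try by right.
  rewrite [s < t0]ltNge (le_trans _ sT)/= ?subr0 ?addr0//.
  by rewrite /T1 lerDl ltW.
move: st0; rewrite neq_lt => /orP[st0|t0s].
  rewrite st0 P_out ?n_out; try by left; exact: ltW.
  by rewrite subr0 addr0 /zp (max_idPl _)// zs.
rewrite [s < t0]ltNge ltW//= /P /n z0_in// add0r.
by case: (leP (z s) 0) => h; case: (leP (- z s) 0) => h'; lra.
Qed.

Let restrict_id u : (forall x, x <= t0 \/ T1 <= x -> u x = 0) -> u \_ `]0, T1[ = u.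
Proof.
move=> u0; apply/funext => x; rewrite patchE mem_setE in_itv/=.
case: (leP x 0) => /= x0; first by rewrite u0//; left; exact: le_trans t00.
by case: (ltP x T1) => // xT; rewrite u0//; right.
Qed.

(** Integrability is recorded with the equation because [conv] and [convE] agree only where it
    holds. *)
Let z_eq : {ae leb, forall t, t0 < t -> t < T1 ->
  [/\ z t = gt t0 t - kap * conv k P t + kap * conv k n t,
    leb.-integrable setT (fun s => (k (t - s) * P s)%:E) &
    leb.-integrable setT (fun s => (k (t - s) * n s)%:E)]}.
Proof.
have iP' : leb.-integrable `]0, T1[ (EFin \o P) by exact: integrableS iP.
have in' : leb.-integrable `]0, T1[ (EFin \o n) by exact: integrableS in_.
have := ae_integrable_frac_int mu0 T1_gt0 iP'; rewrite (restrict_id P_out) => aeP.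
have := ae_integrable_frac_int mu0 T1_gt0 in'; rewrite (restrict_id n_out) => aen.
apply: (@filterS3 _ _ aeF) aeP aen zE => t Pt nt zt t0t tT.
have {}Pt := Pt tT; have {}nt := nt tT; split => //.
rewrite zt ?(le_lt_trans t00)// /gt (frac_intE _ _ (ltW tT)).
suff -> : conv (rkernel mu) (z \_ `]0, T1[) t =
    conv k (past t0) t + conv k P t - conv k n t by ring.
have ipt := ipast_kernel t00 t0t.
rewrite /conv -RintegralD// -RintegralB//; last first.
  by have := integrableD measurableT ipt Pt; exact: eq_integrable.
rewrite /Rintegral; congr fine; apply: integral_eq_ae.
apply: (@filterS _ _ aeF) z_decomp => s -> _.
by rewrite -mulrDr -mulrBr.
Qed.

Let nE := EFin \o n.
Let PE := EFin \o P.
Let nE_ge0 x : (0 <= nE x)%E. Proof. by rewrite lee_fin. Qed.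
Let PE_ge0 x : (0 <= PE x)%E. Proof. by rewrite lee_fin. Qed.
Let mnE : measurable_fun setT nE. Proof. exact/measurable_EFinP. Qed.
Let mPE : measurable_fun setT PE. Proof. exact/measurable_EFinP. Qed.

Let convE_fin u t : leb.-integrable setT (fun s => (k (t - s) * u s)%:E) ->
  convE k (EFin \o u) t = (conv k u t)%:E.
Proof.
move=> it; rewrite /conv /Rintegral fineK; last exact: integrable_fin_num.
by apply: eq_integral => s _; rewrite EFinM.
Qed.

Let P_le : {ae leb, forall t, t0 < t -> t < T1 ->
  (PE t <= (gt t0 t)%:E + kap%:E * convE k nE t)%E}.
Proof.
apply: (@filterS _ _ aeF) z_eq => t h t0t tT.
have [ztE iPt int] := h t0t tT.
rewrite (convE_fin int) -EFinM -EFinD lee_fin /P z0_in//.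
have gp := gt_pos t0t.
have cP : 0 <= conv k P t.
  by apply: Rintegral_ge0 => // s _; rewrite mulr_ge0 ?rkernel_ge0.
have cn : 0 <= conv k n t.
  by apply: Rintegral_ge0 => // s _; rewrite mulr_ge0 ?rkernel_ge0.
rewrite ge_max; apply/andP; split; last by rewrite addr_ge0// mulr_ge0// ltW.
by rewrite ztE lerD2r gerBl mulr_ge0// ltW.
Qed.

(* [gt t0 / rkernel mu (_ - t0)] is nondecreasing, being the product of the
   nondecreasing [gt t0 / rkernel mu] and [rkernel mu / rkernel mu (_ - t0)]. *)
Let gt_le s t : t0 < s -> s < t ->
  gt t0 s <= gt t0 t * (t - t0) `^ (1 - mu) * k (s - t0).
Proof.
move=> t0s st; have s0 : 0 < s by exact: le_lt_trans t0s.
have t_gt0 := lt_trans s0 st.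
have st0 : 0 < s - t0 by rewrite subr_gt0.
have tt0 : 0 < t - t0 by rewrite subr_gt0 (lt_trans t0s).
rewrite /k rkernel_gt0E// -(opprB 1 mu) powRN ler_pdivlMr ?powR_gt0//.
have h1 := gt_mono t00 t0s (ltW st).
have h2 : (s - t0) `^ (1 - mu) * t `^ (1 - mu) <= (t - t0) `^ (1 - mu) * s `^ (1 - mu).
  rewrite -!powRM ?(ltW st0) ?(ltW t_gt0) ?(ltW tt0) ?(ltW s0)//.
  apply: ge0_ler_powR; rewrite ?nnegrE ?subr_ge0//.
  - exact: mulr_ge0 (ltW st0) (ltW t_gt0).
  - exact: mulr_ge0 (ltW tt0) (ltW s0).
  - by rewrite !mulrBl (mulrC t) lerB// ler_wpM2l// ltW.
rewrite -(ler_pM2r (powR_gt0 (1 - mu) s0)).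
apply: (@le_trans _ _ (gt t0 t * t `^ (1 - mu) * (s - t0) `^ (1 - mu))).
  by rewrite mulrAC ler_wpM2r ?powR_ge0.
rewrite -!mulrA ler_wpM2l ?gt_pos ?(lt_trans t0s)//.
by rewrite mulrC.
Qed.

(** One iteration: insert [P_le] into the convolution. By [gt_le] the forcing before [t] is below a
    multiple of a kernel started at [t0]; convolving two kernels gives a Beta factor, and [dBeta]
    brings the result below [gt t0 t]. *)
Let conv_P_le t : t0 < t -> t < T1 ->
  (kap%:E * convE k PE t <=
   (gt t0 t)%:E + (kap ^+ 2)%:E * convE k (convE k nE) t)%E.
Proof.
move=> t0t tT; have gp := gt_pos t0t.
have tt0 : 0 < t - t0 by rewrite subr_gt0.
(* With this constant the majorant [c * k (s - t0)] equals [gt t0 t] at [s = t]. *)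
pose c := gt t0 t * (t - t0) `^ (1 - mu).
have c0 : 0 <= c by rewrite mulr_ge0 ?powR_ge0.
pose kE s := (rkernel mu (s - t0))%:E.
have mkE : measurable_fun setT kE.
  apply/measurable_EFinP; apply: (measurableT_comp (measurable_rkernel _)).
  exact: measurable_funB.
have kE0 s : (0 <= kE s)%E by rewrite lee_fin rkernel_ge0.
have ckE : convE k kE t = (Beta mu mu * rkernel (mu + mu) (t - t0))%:E.
  by rewrite -integral_rkernel_conv//; apply: eq_integral => s _; rewrite EFinM.
pose H := ((fun s => c%:E * kE s) \+ (fun s => kap%:E * convE k nE s))%E.
have mcn := measurable_convE_kernel mnE nE_ge0.
have H1m : measurable_fun setT (fun s => c%:E * kE s)%E by exact: measurable_funeM.
have H2m : measurable_fun setT (fun s => kap%:E * convE k nE s)%E.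
  exact: measurable_funeM.
have H10 s : (0 <= c%:E * kE s)%E.
  by apply: mule_ge0 => //; rewrite lee_fin.
have H20 s : (0 <= kap%:E * convE k nE s)%E.
  by apply: mule_ge0; [rewrite lee_fin ltW|exact: convE_kernel_ge0].
have PH : (convE k PE t <= convE k H t)%E.
  apply: le_convE_kernel => //; first exact: emeasurable_funD.
    by move=> s; rewrite /H adde_ge0.
  apply: (@filterS _ _ aeF) P_le => s h st.
  have [st0|t0s] := leP s t0; first by rewrite /PE/= P_out ?adde_ge0//; left.
  apply: le_trans (h t0s (lt_trans st tT)) _.
  by rewrite /H leeD2r// -EFinM lee_fin gt_le.
apply: (@le_trans _ _ (kap%:E * convE k H t)%E).
  by apply: lee_wpmul2l => //; rewrite lee_fin ltW.
have cn_ge0 s : (0 <= convE k nE s)%E by exact: convE_kernel_ge0.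
rewrite convE_kernelD// (convE_kernelZ t c0 mkE kE0).
rewrite (convE_kernelZ t (ltW kap0) mcn cn_ge0).
rewrite ge0_muleDr; last 2 first.
- by apply: mule_ge0; [rewrite lee_fin|exact: convE_kernel_ge0].
- apply: mule_ge0; first by rewrite lee_fin ltW.
  exact: convE_kernel_ge0.
rewrite [X in (_ + X <= _)%E]muleA -[in X in (_ + X <= _)%E]EFinM -expr2.
apply: leeD2r.
rewrite ckE -!EFinM lee_fin rkernel_gt0E//.
have -> : kap * (c * (Beta mu mu * (t - t0) `^ (mu + mu - 1))) =
    kap * (Beta mu mu * ((t - t0) `^ (1 - mu) * (t - t0) `^ (mu + mu - 1))) * gt t0 t.
  by rewrite /c; ring.
rewrite -powRD; last by rewrite (gt_eqF tt0) implybT.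
rewrite (_ : 1 - mu + _ = mu); last by ring.
rewrite ler_piMl//; apply: le_trans dBeta.
rewrite (ler_wpM2l (ltW kap0))// (ler_wpM2l (ltW (Beta_gt0 mu0 mu0)))//.
have td : t - t0 <= delta by rewrite lerBlDl ltW.
by apply: ge0_ler_powR; rewrite ?nnegrE ?(ltW mu0) ?(ltW tt0) ?(ltW d0).
Qed.

(** Where [z] is negative, the equation bounds [n] by [kap * conv k P - gt t0], and the forcing
    cancels against [conv_P_le]. *)
Let n_le : {ae leb, forall t, (nE t <= (kap ^+ 2)%:E * convE k (convE k nE) t)%E}.
Proof.
have rhs_ge0 t : (0 <= (kap ^+ 2)%:E * convE k (convE k nE) t)%E.
  apply: mule_ge0; first by rewrite lee_fin sqr_ge0.
  by apply: convE_kernel_ge0 => s; exact: convE_kernel_ge0.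
apply: (@filterS _ _ aeF) z_eq => t h.
have [tt0|t0t] := leP t t0; first by rewrite /nE/= n_out//; left.
have [Tt|tT] := leP T1 t; first by rewrite /nE/= n_out//; right.
have [ztE iPt int] := h t0t tT.
have [zt|zt] := leP 0 (z t).
  by rewrite /nE/= /n z0_in// (max_idPr _)// oppr_le0.
have := conv_P_le t0t tT; rewrite {1}/PE (convE_fin iPt) -EFinM => PX.
have cn : 0 <= conv k n t.
  by apply: Rintegral_ge0 => // s _; rewrite mulr_ge0 ?rkernel_ge0.
have nt : n t <= kap * conv k P t - gt t0 t.
  rewrite /n z0_in// (max_idPl _); last by rewrite oppr_ge0 ltW.
  by rewrite ztE opprD opprB gerBl; exact: mulr_ge0 (ltW kap0) cn.
rewrite -(@leeD2lE _ (gt t0 t)%:E)//; apply: le_trans PX.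
by rewrite /nE/= -EFinD lee_fin addrC -lerBrDr.
Qed.

Let kd := trunc_rkernel delta mu.

(** Inside the window all time lags are below [delta], so the integrable kernel can be used. *)
Let convE_trunc (u : R -> \bar R) t : (forall x, x <= t0 -> u x = 0%E) ->
  t < T1 -> convE k u t = convE kd u t.
Proof.
move=> u0 tT; apply: eq_integral => s _.
have [st|ts] := leP s t0; first by rewrite u0// !mule0.
rewrite /kd /trunc_rkernel ifT// ltrBlDr (lt_le_trans tT)// /T1 addrC lerD2l.
exact: ltW.
Qed.

(** Integrating [n_le] bounds the finite integral of [n] by (kap K)^2 times itself, and kap K is at
    most 1/2. *)
Let n_eq0 : {ae leb, forall t, n t = 0}.
Proof.
have mkd : measurable_fun setT kd by exact: measurable_trunc_rkernel.
have kd0 x : 0 <= kd x by exact: trunc_rkernel_ge0.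
have mcn := measurable_convE mkd mnE kd0 nE_ge0.
have cn0 t : (0 <= convE kd nE t)%E by exact: convE_ge0.
have mccn := measurable_convE mkd mcn kd0 cn0.
have n_out0 x : x <= t0 -> nE x = 0%E by move=> h; rewrite /nE/= n_out//; left.
have n_le' : {ae leb, forall t, (nE t <= (kap ^+ 2)%:E * convE kd (convE kd nE) t)%E}.
  apply: (@filterS _ _ aeF) n_le => t.
  have [Tt _|tT] := leP T1 t.
    rewrite {1}/nE/= n_out; last by right.
    by apply: mule_ge0; [rewrite lee_fin sqr_ge0|exact: convE_ge0].
  have conv_out0 x : x <= t0 -> convE k nE x = 0%E.
    move=> xt0; rewrite /convE integral0_eq// => s _.
    have [st|ts] := leP s t0; first by rewrite n_out0// mule0.
    by rewrite /k rkernel_le0E ?mul0e// subr_le0 (le_trans xt0)// ltW.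
  rewrite (convE_trunc conv_out0 tT).
  suff -> : convE kd (convE k nE) t = convE kd (convE kd nE) t by [].
  apply: eq_integral => s _; have [ts|st] := leP t s.
    by rewrite /kd /trunc_rkernel rkernel_le0E ?subr_le0// if_same !mul0e.
  by rewrite (convE_trunc n_out0)// (lt_trans st).
pose I := (\int[leb]_t nE t)%E.
have I0 : (0 <= I)%E by apply: integral_ge0.
have Ifin : I \is a fin_num by apply: integrable_fin_num.
pose K := delta `^ mu / mu.
have Ile : (I <= (kap ^+ 2)%:E * (K%:E * (K%:E * I)))%E.
  rewrite -[K%:E](integral_trunc_rkernel mu0 (ltW d0)) -/kd.
  rewrite -(integral_convE mkd mnE kd0 nE_ge0) -(integral_convE mkd mcn kd0 cn0).
  rewrite -ge0_integralZl//; last by rewrite lee_fin sqr_ge0.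
  apply: ae_ge0_le_integral => //.
  - by move=> t _; rewrite mule_ge0 ?lee_fin ?sqr_ge0//; exact: convE_ge0.
  - exact: measurable_funeM.
  - by apply: (@filterS _ _ aeF) n_le' => t h _.
  - by move=> t _; exact: convE_ge0.
have I_eq0 : I = 0%E.
  move: Ile I0; rewrite -(fineK Ifin) -!EFinM !lee_fin => Ile I0.
  congr EFin; apply/eqP; rewrite eq_le I0 andbT.
  have K0 : 0 <= kap * K by rewrite mulr_ge0 ?divr_ge0 ?powR_ge0 ?ltW.
  have : (kap * K) ^+ 2 <= (1 / 2) ^+ 2.
    by rewrite lerXn2r ?nnegrE//; lra.
  have : kap ^+ 2 * (K * (K * fine I)) = (kap * K) ^+ 2 * fine I by ring.
  by move: Ile => /[swap] ->; move: ((kap * K) ^+ 2) => c; nra.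
have : ae_eq leb setT nE (cst 0%E).
  apply/(ae_eq_integral_abs leb measurableT mnE); rewrite -I_eq0.
  by apply: eq_integral => t _; rewrite gee0_abs.
apply: (@filterS _ _ aeF) => t h.
by have [] := h Logic.I.
Qed.

Lemma comparison_step : {ae leb, forall t, 0 < t -> t < T1 -> 0 <= z t}.
Proof.
apply: (@filterS3 _ _ aeF) past_pos (ae_neq t0) n_eq0 => t zt tt0 nt t_gt0 tT.
move: tt0; rewrite neq_lt => /orP[tt0|t0t]; first exact: zt.
move: nt; rewrite /n z0_in//; case: (leP (- z t) 0); first by rewrite oppr_le0.
by move=> + h; rewrite h ltxx.
Qed.

End Step.

(** The invariant of the propagation: the next step needs the sign of the restarted forcing as well
    as that of [z]. *)
Let nonneg_until t := [/\ 0 <= t,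
  {ae leb, forall s, 0 < s -> s < t -> 0 <= z s} &
  forall s, t < s -> 0 <= gt t s].

Let nonneg_until0 : nonneg_until 0.
Proof.
split => //.
  apply: aeW.
  by move=> s s0 sn0; have := lt_trans s0 sn0; rewrite ltxx.
move=> s s0; rewrite /gt (_ : past 0 = cst 0); last first.
  by rewrite /past set_itvoo0 patch_set0.
rewrite /conv /Rintegral; under eq_integral do rewrite mulr0.
by rewrite integral0 mulr0 subr0 g_ge0.
Qed.

(** The restart time [t1] is a generic point of the second half of the window: there [z] is
    nonnegative, the equation holds and the history is integrable. The second half guarantees
    progress by at least [delta / 2]. *)
Let nonneg_until_step t0 : nonneg_until t0 ->
  exists2 t1, t0 + delta / 2 < t1 & nonneg_until t1.
Proof.
move=> [t00 past_pos gt_pos].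
have pos := comparison_step t00 past_pos gt_pos.
set T1 := t0 + delta in pos.
have T1_gt0 : 0 < T1 by exact: ltr_wpDl.
have aei := ae_integrable_frac_int mu0 T1_gt0 (izp T1_gt0).
have h : t0 + delta / 2 < T1 by rewrite /T1 ltrD2l; have := d0; lra.
have [t1 /andP[t1l t1r] [zt1 zt1E it1]] := ae_exists_itv h
  (@filterS3 _ _ aeF _ _ _ (fun t => [/\ (0 < t -> t < T1 -> 0 <= z t),
     (0 < t -> z t = g t - kap * frac_int mu z t) & (t < T1 -> leb.-integrable setT
        (fun x => (rkernel mu (t - x) * (zp \_ `]0, T1[) x)%:E))])
    (fun t h1 h2 h3 => And3 h1 h2 h3) pos zE aei).
have t1_gt0 : 0 < t1 by apply: le_lt_trans t1l; rewrite addr_ge0// ltW// divr_gt0.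
exists t1 => //; split; first exact: ltW.
  apply: (@filterS _ _ aeF) pos => s zs s0 st1.
  exact: zs s0 (lt_trans st1 t1r).
have ipast1 : leb.-integrable setT (fun x => (k (t1 - x) * past t1 x)%:E).
  apply: eq_integrable (it1 t1r) => // x _; congr EFin.
  rewrite /past !patchE !mem_setE !in_itv/=.
  have [xt|xt] := ltP x t1; first by rewrite (lt_trans xt t1r) !andbT.
  by rewrite andbF /k rkernel_le0E ?subr_le0// !mul0r.
(* Hence [gt t1 t1] equals [z t1], which is nonnegative; weighted monotonicity carries the sign to
   later times. *)
have convE1 : conv k (past t1) t1 = frac_int mu z t1.
  rewrite -(frac_intE _ _ (lexx t1)); apply: frac_int_eq_ae.
  apply: (@filterS _ _ aeF) pos => s zs s0 st1.
  by rewrite /zp (max_idPl _)// zs// (lt_trans st1).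
move=> t t1t; have t_gt0 := lt_trans t1_gt0 t1t.
rewrite -(pmulr_lge0 _ (powR_gt0 (1 - mu) t_gt0)).
have zt1_ge0 : 0 <= z t1 * t1 `^ (1 - mu) by rewrite mulr_ge0 ?powR_ge0 ?zt1.
apply: le_trans zt1_ge0 _; rewrite zt1E// -convE1 /gt [leLHS]mulrBl [leRHS]mulrBl lerB//.
  by apply: g_mono => //; exact: ltW.
rewrite -[leLHS]mulrA -[leRHS]mulrA (ler_wpM2l (ltW kap0))//.
apply: conv_past_mono => //; [exact: ltW|exact: ltW|].
by apply: ipast_kernel => //; exact: ltW.
Qed.

Lemma volterra_ge0_uniform : {ae leb, forall t, 0 < t -> 0 <= z t}.
Proof.
have until (m : nat) : exists2 t, m%:R * (delta / 2) <= t & nonneg_until t.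
  elim: m => [|m [t mt /nonneg_until_step[t1 tt1 nt1]]].
    by exists 0; [rewrite mul0r|exact: nonneg_until0].
  exists t1 => //; rewrite -natr1 mulrDl mul1r.
  by apply: le_trans (ltW tt1); rewrite lerD2r.
apply: ae_pos_bounded => T T0.
have [t Tt [_ pos _]] := until (Num.truncn (T / (delta / 2))).+1.
apply: (@filterS _ _ aeF) pos => s zs s0 sT; apply: zs => //.
apply: lt_le_trans Tt; apply: (lt_trans sT).
rewrite -ltr_pdivrMr ?divr_gt0//; exact: truncnS_gt.
Qed.

End Comparison.

Section ComparisonPrinciple.
Context {R : realType}.
Local Notation leb := (@lebesgue_measure R).

Lemma volterra_ge0 (mu kap : R) (z g : R -> R) : 0 < mu -> mu <= 1 -> 0 < kap ->
  (forall T, 0 < T -> leb.-integrable `]0, T[ (EFin \o z)) ->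
  {ae leb, forall t, 0 < t -> z t = g t - kap * frac_int mu z t} ->
  (forall t, 0 < t -> 0 <= g t) ->
  (forall s t, 0 < s -> s <= t -> g s * s `^ (1 - mu) <= g t * t `^ (1 - mu)) ->
  {ae leb, forall t, 0 < t -> 0 <= z t}.
Proof.
move=> mu0 mu1 kap0 iz zE g0 gm.
have B0 := Beta_gt0 mu0 mu0.
(* The largest value of [delta] to the power [mu] that meets both smallness conditions. *)
pose c := Num.min (kap * Beta mu mu)^-1 (mu / (2 * kap)).
have c0 : 0 < c.
  by rewrite lt_min invr_gt0 mulr_gt0//= divr_gt0 ?mulr_gt0.
pose delta := c `^ mu^-1.
have dE : delta `^ mu = c by rewrite -powRrM mulVf ?gt_eqF// powRr1 ?ltW.
apply: (volterra_ge0_uniform mu0 mu1 kap0 iz zE g0 gm (delta := delta)).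
- exact: powR_gt0.
- rewrite dE mulrA -ler_pdivlMl ?mulr_gt0// mulr1.
  by rewrite /c ge_min lexx.
- have : c <= mu / (2 * kap) by rewrite /c ge_min lexx orbT.
  rewrite dE mulrA ler_pdivrMr// => h.
  have -> : 1 / 2 * mu = kap * (mu / (2 * kap)) by field; rewrite gt_eqF.
  by rewrite ler_wpM2l// ltW.
Qed.

End ComparisonPrinciple.

(** * Supersolutions and decay *)

Section Domination.
Context {R : realType}.
Local Notation leb := (@lebesgue_measure R).
Local Notation aeF := (ae_filter_ringOfSetsType leb).
Implicit Types (s t T : R) (u v : R -> R).

(** Almost everywhere only, since the integrals on the right converge for almost every [t]. *)
Lemma ae_frac_intD a c u v : 0 < a ->
  (forall T, 0 < T -> leb.-integrable `]0, T[ (EFin \o u)) ->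
  (forall T, 0 < T -> leb.-integrable `]0, T[ (EFin \o v)) ->
  {ae leb, forall t, 0 < t ->
    frac_int a (fun s => u s + c * v s) t = frac_int a u t + c * frac_int a v t}.
Proof.
move=> a0 iu iv; apply: ae_pos_bounded => T T0.
apply: (@filterS2 _ _ aeF) (ae_integrable_frac_int a0 T0 (iu T T0))
  (ae_integrable_frac_int a0 T0 (iv T T0)) => t hu hv _ tT.
have {}hu := hu tT; have {}hv := hv tT.
rewrite !(frac_intE _ _ (ltW tT)) /conv -RintegralZl// -RintegralD//; last first.
  by have := integrableZl measurableT c hv; exact: eq_integrable.
apply: eq_Rintegral => s _; rewrite !patchE; case: ifP => _; last by rewrite !mulr0 addr0.
by ring.
Qed.

(** By linearity [W + sg * q] solves the Volterra equation with forcing [g]; comparison for both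
    signs [sg] gives the two-sided bound. *)
Lemma volterra_dominated (mu kap : R) (q W V h : R -> R) :
  0 < mu -> mu <= 1 -> 0 < kap ->
  (forall T, 0 < T -> leb.-integrable `]0, T[ (EFin \o q)) ->
  (forall T, 0 < T -> leb.-integrable `]0, T[ (EFin \o W)) ->
  {ae leb, forall t, 0 < t -> q t = h t - kap * frac_int mu q t} ->
  {ae leb, forall t, 0 < t -> frac_int mu W t = V t} ->
  (forall sg : R, sg ^+ 2 = 1 -> let g t := W t + kap * V t + sg * h t in
    (forall t, 0 < t -> 0 <= g t) /\
    forall s t, 0 < s -> s <= t -> g s * s `^ (1 - mu) <= g t * t `^ (1 - mu)) ->
  {ae leb, forall t, 0 < t -> `|q t| <= W t}.
Proof.
move=> mu0 mu1 kap0 iq iW qE WV super.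
have signed (sg : R) : sg ^+ 2 = 1 -> {ae leb, forall t, 0 < t -> 0 <= W t + sg * q t}.
  move=> /super/= [g0 gm].
  apply: (volterra_ge0 mu0 mu1 kap0 _ _ g0 gm).
    move=> T T0; apply: integrable_real_add; first exact: iW.
    by apply: integrable_real_scale; exact: iq.
  apply: (@filterS3 _ _ aeF) qE WV (ae_frac_intD sg mu0 iW iq) => t qt Vt fD t0.
  by rewrite fD// Vt// [in LHS]qt//; ring.
apply: (@filterS2 _ _ aeF) (signed 1 (expr1n _ _)) (signed (-1) _).
  move=> t h1 h2 t0; rewrite ler_norml.
  by have := h1 t0; have := h2 t0; rewrite mul1r mulN1r => *; apply/andP; split; lra.
by rewrite sqrrN expr1n.
Qed.

Lemma frac_int_powRN a b t : 0 < a -> b < 1 -> 0 < t ->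
  frac_int a (fun s => s `^ (- b)) t = Beta a (1 - b) * t `^ (a - b).
Proof.
move=> a0 b1 t0; rewrite (frac_intE _ _ (lexx t)) /conv /Rintegral.
have b'0 : 0 < 1 - b by rewrite subr_gt0.
transitivity (fine (\int[leb]_x (rkernel a (t - x) * rkernel (1 - b) (x - 0))%:E)%E).
  congr fine; apply: eq_integral => x _; rewrite subr0 patchE mem_setE in_itv/=.
  congr EFin; have [x0|x0] := ltP 0 x; last first.
    by rewrite (@rkernel_le0E _ (1 - b) _ x0) !mulr0.
  rewrite (@rkernel_gt0E _ (1 - b) _ x0) addrAC subrr sub0r.
  case: (ltP x t) => //= tx; rewrite (@rkernel_le0E _ a (t - x)) ?mul0r//.
  by rewrite subr_le0.
rewrite integral_rkernel_conv//= subr0 rkernel_gt0E//.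
by congr (_ * _ `^ _); ring.
Qed.

Lemma powRN_cvg0 b : 0 < b -> t `^ (- b) @[t --> +oo] --> (0 : R).
Proof.
move=> b0; apply/cvgrPdist_le => e e0; near=> t.
have t0 : 0 < t by near: t; exact: nbhs_pinfty_gt.
rewrite sub0r normrN ger0_norm ?powR_ge0// powRN.
have te : e^-1 `^ b^-1 <= t by near: t; exact: nbhs_pinfty_ge.
rewrite -[leRHS]invrK lef_pV2 ?posrE ?powR_gt0 ?invr_gt0//.
have -> : e^-1 = (e^-1 `^ b^-1) `^ b.
  by rewrite -powRrM mulVf ?gt_eqF// powRr1// invr_ge0 ltW.
apply: ge0_ler_powR => //; rewrite ?nnegrE ?powR_ge0 ?ltW//.
Unshelve. all: by end_near. Qed.

Lemma powR_interp c1 c c2 t : 0 < t -> c1 <= c -> c <= c2 ->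
  t `^ c <= t `^ c1 + t `^ c2.
Proof.
move=> t0 c1c cc2; have [t1|t1] := leP t 1.
  rewrite -[leLHS]addr0 lerD ?powR_ge0//.
  by apply: ger_powR => //; rewrite t0.
rewrite -[leLHS]add0r lerD ?powR_ge0//.
by apply: ler_powR => //; exact: ltW.
Qed.

(** In the derivative the middle power is at most the sum of the two outer ones, whose coefficients
    both dominate its own. *)
Lemma powR_combination_mono (x1 x x2 c1 c c2 : R) s t :
  c1 <= c -> c <= c2 -> `|x * c| <= x1 * c1 -> `|x * c| <= x2 * c2 ->
  0 < s -> s <= t ->
  x1 * s `^ c1 + x2 * s `^ c2 + x * s `^ c <= x1 * t `^ c1 + x2 * t `^ c2 + x * t `^ c.
Proof.
move=> c1c cc2 h1 h2 s0 st.
pose f r : R := x1 * r `^ c1 + x2 * r `^ c2 + x * r `^ c.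
pose f' r : R := x1 * (c1 * r `^ (c1 - 1)) + x2 * (c2 * r `^ (c2 - 1)) +
  x * (c * r `^ (c - 1)).
have der (r : R) : 0 < r -> is_derive r 1 f (f' r).
  move=> r0; have d1 := is_derive1_powR c1 r0; have d2 := is_derive1_powR c2 r0.
  have d := is_derive1_powR c r0.
  have D y e de : is_derive r 1 (fun r : R => r `^ e) de ->
      is_derive r 1 (fun r : R => y * r `^ e) (y * de).
    by move=> he; exact: (@is_deriveZ _ _ _ (fun r : R => r `^ e) y r 1 de he).
  exact: is_deriveD (is_deriveD (D x1 c1 _ d1) (D x2 c2 _ d2)) (D x c _ d).
have fE (r : R) : 0 < r -> 0 <= f' r.
  move=> r0; rewrite /f' !mulrA.
  have := powR_interp r0 (lerB c1c (lexx 1)) (lerB cc2 (lexx 1)).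
  have p1 := powR_ge0 r (c1 - 1); have p2 := powR_ge0 r (c2 - 1).
  have p := powR_ge0 r (c - 1) => pp.
  have a1 : `|x * c| * r `^ (c1 - 1) <= x1 * c1 * r `^ (c1 - 1) by rewrite ler_wpM2r.
  have a2 : `|x * c| * r `^ (c2 - 1) <= x2 * c2 * r `^ (c2 - 1) by rewrite ler_wpM2r.
  have a3 : `|x * c| * r `^ (c - 1) <= `|x * c| * (r `^ (c1 - 1) + r `^ (c2 - 1)).
    by rewrite ler_wpM2l.
  have a4 : - (x * c) * r `^ (c - 1) <= `|x * c| * r `^ (c - 1).
    by rewrite ler_wpM2r// -normrN ler_norm.
  move: a1 a2 a3 a4; rewrite mulrDr mulNr; lra.
have := @ger0_derive1_le_oo R f 0 (t + 1) _ _ _ s t _ _ st; apply.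
- by move=> r; rewrite in_itv/= => /andP[/der[]].
- by move=> r; rewrite in_itv/= derive1E => /andP[r0 _]; have [_ ->] := der r r0; exact: fE.
- move=> r; rewrite inE/= in_itv/= => /andP[r0 _].
  by apply/differentiable_continuous/derivable1_diffP; have [] := der r r0.
- by rewrite in_itv/= s0 (le_lt_trans st)// ltrDl.
- by rewrite in_itv/= (lt_le_trans s0)//= ltrDl.
Qed.

End Domination.

(** * Decaying bounds for the Volterra equation *)

Section Decay.
Context {R : realType}.
Local Notation leb := (@lebesgue_measure R).
Local Notation aeF := (ae_filter_ringOfSetsType leb).
Implicit Types (s t T : R).

Lemma continuous_powR_pos (b t : R) : 0 < t -> {for t, continuous (fun s : R => s `^ b)}.
Proof.
move=> t0; apply/differentiable_continuous/derivable1_diffP.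
by have [] := is_derive1_powR b t0.
Qed.

(** The power t^(-a) in the forcing is matched by the same power in [W]. It decays only for [a > 0];
    otherwise [C] has to be 0 and a constant term belongs in [e]. *)
Lemma volterra_decay_lt1 (mu kap a C e : R) (q : R -> R) :
  0 < mu -> mu < 1 -> 0 < kap -> 0 <= a -> a <= 1 - mu -> C = 0 \/ 0 < a ->
  (forall T, 0 < T -> leb.-integrable `]0, T[ (EFin \o q)) ->
  {ae leb, forall t, 0 < t -> q t = C * t `^ (- a) + e - kap * frac_int mu q t} ->
  exists W : R -> R, [/\ W t @[t --> +oo] --> 0,
    forall t, 0 < t -> {for t, continuous W} &
    {ae leb, forall t, 0 < t -> `|q t| <= W t}].
Proof.
move=> mu0 mu1 kap0 a0 a_le Ca iq qE.
(* Below [mu], so that t^(mu - th) grows, and below 1 - mu, so that t^(- th) times the weight t^(1 -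
   mu) still increases. *)
pose th := Num.min mu (1 - mu) / 2.
have th0 : 0 < th by rewrite divr_gt0// lt_min mu0 subr_gt0.
have th_mu : th < mu.
  have : Num.min mu (1 - mu) <= mu by rewrite ge_min lexx.
  by rewrite /th; lra.
have th_1mu : th < 1 - mu.
  have : Num.min mu (1 - mu) <= 1 - mu by rewrite ge_min lexx orbT.
  by rewrite /th; lra.
have th1 : th < 1 by lra.
have a1 : a < 1 by lra.
pose B := Beta mu (1 - th); pose Ba := Beta mu (1 - a).
have B0 : 0 < B by apply: Beta_gt0; lra.
have Ba0 : 0 < Ba by apply: Beta_gt0; lra.
(* The exponents of the two [A]-terms after multiplication by t^(1 - mu). *)
pose x1 := 1 - mu - th; pose x2 := 1 - th.
have x10 : 0 < x1 by rewrite /x1; lra.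
have x20 : 0 < x2 by rewrite /x2; lra.
have kB0 : 0 < kap * B by rewrite mulr_gt0.
(* One summand for each of the four lower bounds on [A] below: two for the sign of the forcing, two
   for its monotonicity. *)
pose A := `|e| * (1 + x1^-1 + (kap * B)^-1 + (kap * B * x2)^-1).
have e0 : 0 <= `|e| by [].
have i1 : 0 < x1^-1 by rewrite invr_gt0.
have i2 : 0 < (kap * B)^-1 by rewrite invr_gt0.
have i3 : 0 < (kap * B * x2)^-1 by rewrite invr_gt0 mulr_gt0.
have A0 : 0 <= A by rewrite mulr_ge0//; lra.
have A_e : `|e| <= A by rewrite /A ler_peMr//; lra.
have A_x1 : `|e| <= A * x1.
  by rewrite -ler_pdivrMr// /A ler_wpM2l//; lra.
have A_B : `|e| <= A * (kap * B).
  by rewrite -ler_pdivrMr// /A ler_wpM2l//; lra.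
have A_Bx2 : `|e| <= A * (kap * B * x2).
  by rewrite -ler_pdivrMr ?mulr_gt0// /A ler_wpM2l//; lra.
pose W t := A * t `^ (- th) + `|C| * t `^ (- a).
have iW T : 0 < T -> leb.-integrable `]0, T[ (EFin \o W).
  by move=> T0; apply: integrable_real_add; apply: integrable_real_scale;
    apply: integrable_powRN.
pose V t := A * (B * t `^ (mu - th)) + `|C| * (Ba * t `^ (mu - a)).
have WV : {ae leb, forall t, 0 < t -> frac_int mu W t = V t}.
  have iu T : 0 < T -> leb.-integrable `]0, T[ (EFin \o (fun s => A * s `^ (- th))).
    by move=> T0; apply: integrable_real_scale; exact: integrable_powRN.
  have iv T : 0 < T -> leb.-integrable `]0, T[ (EFin \o (fun s => s `^ (- a))).
    by move=> T0; exact: integrable_powRN.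
  apply: (@filterS _ _ aeF) (ae_frac_intD `|C| mu0 iu iv) => t h t0.
  rewrite h// frac_intZ; last by apply: measurable_funTS; exact: measurable_powR.
  by rewrite !frac_int_powRN.
exists W; split.
- rewrite (_ : 0 = A * 0 + `|C| * 0); last by rewrite !mulr0 addr0.
  apply: cvgD; first by apply: cvgMr; exact: powRN_cvg0.
  have [->|a_gt0] := Ca; last by apply: cvgMr; exact: powRN_cvg0.
  rewrite normr0 mul0r (_ : (fun t => _) = cst 0); first exact: cvg_cst.
  by apply/funext => t /=; rewrite mul0r.
- move=> t t0; apply: continuousD; apply: continuousM;
    by [exact: cst_continuous|exact: continuous_powR_pos].
apply: (volterra_dominated mu0 (ltW mu1) kap0 iq iW qE WV) => sg sg2 /=.
have sg1 : `|sg| = 1 by apply/eqP; rewrite -sqrp_eq1// -normrX sg2 normr1.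
have sge : `|sg * e| = `|e| by rewrite normrM sg1 mul1r.
have sgC : 0 <= `|C| + sg * C.
  have <- : `|sg * C| = `|C| by rewrite normrM sg1 mul1r.
  by rewrite -lerBlDr sub0r -normrN ler_norm.
have kCB : 0 <= kap * `|C| * Ba.
  by apply: mulr_ge0 (ltW Ba0); apply: mulr_ge0 (ltW kap0) _.
have sge' : - `|e| <= sg * e by rewrite -sge lerNl -normrN ler_norm.
split.
  (* The constant [e] is absorbed by t^(- th) for small times and by t^(mu - th) for large ones. *)
  move=> t t0; have := @powR_interp R (- th) 0 (mu - th) t t0 (ltac:(lra)) (ltac:(lra)).
  rewrite powRr0 => i; have p1 := powR_ge0 t (- th); have p2 := powR_ge0 t (mu - th).
  have pa := powR_ge0 t (- a); have pma := powR_ge0 t (mu - a).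
  have -> : W t + kap * V t + sg * (C * t `^ (- a) + e) =
    (A * t `^ (- th) + A * (kap * B) * t `^ (mu - th) + sg * e) +
    (`|C| + sg * C) * t `^ (- a) + kap * `|C| * Ba * t `^ (mu - a).
    by rewrite /W /V; ring.
  rewrite addr_ge0//; last exact: mulr_ge0.
  rewrite addr_ge0//; last exact: mulr_ge0.
  have b1 : `|e| * t `^ (- th) <= A * t `^ (- th) by rewrite ler_wpM2r.
  have b2 : `|e| * t `^ (mu - th) <= A * (kap * B) * t `^ (mu - th).
    by rewrite ler_wpM2r.
  have b3 : `|e| * 1 <= `|e| * (t `^ (- th) + t `^ (mu - th)) by rewrite ler_wpM2l.
  by move: b3; rewrite mulr1 mulrDr; lra.
have weighted t : 0 < t ->
    (W t + kap * V t + sg * (C * t `^ (- a) + e)) * t `^ (1 - mu) =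
    (A * t `^ x1 + A * (kap * B) * t `^ x2 + (sg * e) * t `^ (1 - mu)) +
    (`|C| + sg * C) * t `^ (1 - mu - a) + kap * `|C| * Ba * t `^ (1 - a).
  move=> t0; have D (x y : R) : t `^ (x + y) = t `^ x * t `^ y.
    by rewrite powRD// (gt_eqF t0) implybT.
  rewrite (_ : x1 = - th + (1 - mu)); last by rewrite /x1; ring.
  rewrite (_ : x2 = (mu - th) + (1 - mu)); last by rewrite /x2; ring.
  rewrite (_ : 1 - mu - a = - a + (1 - mu)); last by ring.
  rewrite (_ : 1 - a = (mu - a) + (1 - mu)); last by ring.
  by rewrite (D (- th)) (D (mu - th)) (D (- a)) (D (mu - a)) /W /V; ring.
move=> s t s0 st; rewrite !weighted//; last exact: lt_le_trans st.
have mono x : 0 <= x -> s `^ x <= t `^ x.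
  move=> x0; apply: ge0_ler_powR; rewrite ?nnegrE ?(ltW s0)//.
  exact: le_trans (ltW s0) st.
apply: lerD; last by rewrite (ler_wpM2l kCB)// mono// subr_ge0 ltW.
apply: lerD; last by rewrite (ler_wpM2l sgC)// mono// subr_ge0.
have n1 : `|sg * e * (1 - mu)| <= `|e|.
  by rewrite normrM sge ler_piMr// ger0_norm; lra.
apply: powR_combination_mono => //.
- by rewrite /x1; lra.
- by rewrite /x2; lra.
- exact: le_trans n1 A_x1.
- by rewrite -[leRHS]mulrA; exact: le_trans n1 A_Bx2.
Qed.

(** [W] solves the equation with forcing [|e|] exactly, so the comparison forcing is the nonnegative
    constant [|e| + sg * e], and the weight is trivial. *)
Lemma volterra_decay_eq1 (kap e : R) (q : R -> R) : 0 < kap ->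
  (forall T, 0 < T -> leb.-integrable `]0, T[ (EFin \o q)) ->
  {ae leb, forall t, 0 < t -> q t = e - kap * frac_int 1 q t} ->
  exists W : R -> R, [/\ W t @[t --> +oo] --> 0,
    forall t, 0 < t -> {for t, continuous W} &
    {ae leb, forall t, 0 < t -> `|q t| <= W t}].
Proof.
move=> kap0 iq qE; pose W t := `|e| * expR (- (kap * t)).
have cW t : {for t, continuous W}.
  apply: continuousM; first exact: cst_continuous.
  apply: continuous_comp; last exact: continuous_expR.
  apply: (@continuousN _ R^o).
  by apply: continuousM => //; exact: cst_continuous.
have iW T : 0 < T -> leb.-integrable `]0, T[ (EFin \o W).
  move=> T0; apply: (@integrableS _ _ _ leb `[0, T]%classic) => //.
    exact: subset_itv_oo_cc.
  apply: continuous_compact_integrable; first exact: segment_compact.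
  by apply: continuous_subspaceT => t; exact: cW.
exists W; split.
- rewrite -(mulr0 `|e|); apply: cvgMr.
  rewrite (_ : (fun t => _) = (fun z => expR (- z)) \o (fun t => kap * t))//.
  apply: (@cvg_comp _ _ _ _ _ _ (pinfty_nbhs R)); last exact: cvgr_expR.
  exact: gt0_cvgMry.
- by move=> t _; exact: cW.
pose V t := `|e| / kap * (1 - expR (- (kap * t))).
have WV t : 0 < t -> frac_int 1 W t = V t.
  move=> t0; rewrite frac_int1.
  (* The primitive of [W] is read off the distribution function of the exponential law of rate
     [kap]. *)
  have := @exponential_prob_itv0c R kap t t0.
  rewrite /exponential_prob => h.
  rewrite Rintegral_itv_bndo_bndc; last exact: iW.
  rewrite Rintegral_itv_obnd_cbnd; last first.
    apply: (@integrableS _ _ _ leb `]0, (t + 1)[%classic) => //; last first.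
      by apply: iW; rewrite addr_gt0.
    by apply: subset_itvl; rewrite bnd_simp ltrDl.
  transitivity (\int[leb]_(s in `[0, t]) (`|e| / kap * exponential_pdf kap s)).
    apply: eq_Rintegral => s; rewrite inE => s0t.
    rewrite exponential_pdfE; last by move: s0t; rewrite /= in_itv/= => /andP[].
    by rewrite /W mulNr; field; rewrite gt_eqF.
  rewrite RintegralZl//; last first.
    apply: integrableS (integrable_exponential_pdf kap0) => //.
  by rewrite /Rintegral h /= mulNr.
apply: (volterra_dominated ltr01 (lexx 1) kap0 iq iW qE (V := V)).
  by apply: aeW => t; exact: WV.
move=> sg sg2 /=.
have sg1 : `|sg| = 1 by apply/eqP; rewrite -sqrp_eq1// -normrX sg2 normr1.
have sge : - `|e| <= sg * e.
  by rewrite -[`|e|]mul1r -sg1 -normrM lerNl -normrN ler_norm.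
have gE t : W t + kap * V t + sg * e = `|e| + sg * e.
  by rewrite /W /V; field; rewrite gt_eqF.
split=> [t t0|s t s0 st]; first by rewrite gE; lra.
by rewrite !gE subrr !powRr0.
Qed.

(** By continuity a violation at [t] persists on an interval to the left of [t], which is not a null
    set. *)
Lemma ae_le_continuous (u v : R -> R) :
  (forall t, 0 < t -> {for t, continuous u}) ->
  (forall t, 0 < t -> {for t, continuous v}) ->
  {ae leb, forall t, 0 < t -> u t <= v t} -> forall t, 0 < t -> u t <= v t.
Proof.
move=> cu cv uv t t0; rewrite leNgt; apply/negP => vu.
have c : {for t, continuous (u \- v)} by apply: continuousB; [exact: cu|exact: cv].
have uv0 : 0 < (u \- v) t by rewrite /= subr_gt0.
have [e /= e0 near_t] : \forall s \near t, 0 < (u \- v) s.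
  exact: (cvgr_gt _ c).
have te : Num.max 0 (t - e) < t by rewrite gt_max t0 gtrBl.
have [s /andP[ls st] uvs] := ae_exists_itv te uv.
move: ls; rewrite gt_max => /andP[s0 es].
have : 0 < (u \- v) s.
  by apply: near_t; rewrite /= gtr0_norm ?subr_gt0// ltrBlDl -ltrBlDr.
by rewrite /= subr_gt0 ltNge uvs.
Qed.

End Decay.

Theorem theorem3p2 (R : realType) (alpha beta alpha1 beta1 mu nu : R)
    (beta_neq0 : beta != 0) (beta_neq_beta1 : beta != beta1)
    (mu_gt0 : 0 < mu) (mu_le1 : mu <= 1)
    (nu_ge0 : 0 <= nu) (nu_le1 : nu <= 1)
    (stable : beta1 / beta < 1)
    (p : R -> R) (solution_p : cobweb_solution alpha beta alpha1 beta1 mu nu p) :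
  p t @[t --> +oo] --> (alpha1 - alpha) / (beta - beta1).
Proof.
have [C [k [k0 qE]]] := cobweb_volterra beta_neq0 beta_neq_beta1 mu_gt0 mu_le1
  nu_ge0 nu_le1 stable solution_p.
case: solution_p => cp ip _ _.
set pe := (alpha1 - alpha) / (beta - beta1) in qE *.
set a := (1 - nu) * (1 - mu) in qE.
have a0 : 0 <= a by rewrite mulr_ge0 ?subr_ge0.
have a1 : a <= 1 - mu by rewrite ler_piMl ?subr_ge0// gerBl.
pose q t := p t - pe.
have iq T : 0 < T -> (@lebesgue_measure R).-integrable `]0, T[ (EFin \o q).
  by move=> T0; exact: integrable_real_sub (ip T T0) (integrable_itv_cst 0 T pe).
have [W [W0 cW qW]] : exists W : R -> R, [/\ W t @[t --> +oo] --> 0,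
    forall t, 0 < t -> {for t, continuous W} &
    {ae @lebesgue_measure R, forall t, 0 < t -> `|q t| <= W t}].
  (* When [mu = 1], or more generally [a = 0], the power t^(-a) is constant and [C] joins the
     constant term. *)
  have [mu1|mu1] := eqVneq mu 1.
    apply: (volterra_decay_eq1 k0 iq (e := C - pe)).
    apply: (@filterS _ _ (ae_filter_ringOfSetsType _)) qE => t h t0.
    by rewrite /q h// /a mu1 subrr mulr0 oppr0 powRr0 mulr1.
  have {}mu1 : mu < 1 by rewrite lt_neqAle mu1.
  have [a_eq0|a_neq0] := eqVneq a 0.
    apply: (volterra_decay_lt1 mu_gt0 mu1 k0 (lexx 0) _ (or_introl erefl) iq
      (e := C - pe)); first by rewrite subr_ge0.
    apply: (@filterS _ _ (ae_filter_ringOfSetsType _)) qE => t h t0.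
    by rewrite /q h// a_eq0 oppr0 powRr0 mulr1 mul0r add0r.
  have a_gt0 : 0 < a by rewrite lt_neqAle eq_sym a_neq0.
  exact: (volterra_decay_lt1 mu_gt0 mu1 k0 a0 a1 (or_intror a_gt0) iq qE).
have cq t : 0 < t -> {for t, continuous q}.
  by move=> t0; apply: continuousB; [exact: cp|exact: cst_continuous].
have qleW t : 0 < t -> `|q t| <= W t.
  apply: (@ae_le_continuous _ (fun t => `|q t|) W _ cW qW) => s s0.
  exact: (continuous_comp (cq s s0) (@norm_continuous _ _ _)).
apply/subr_cvg0; apply/norm_cvg0P.
apply: (squeeze_cvgr _ (@cvg_cst _ _ _ _ _) W0).
near=> t; rewrite normr_ge0/=; apply: qleW.
by near: t; exact: nbhs_pinfty_gt.
Unshelve. all: by end_near. Qed.
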